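(* Let $(\phi^n,\psi^n,U^n,\boldsymbol{u}^n,p^n)_{n\ge 0}$ and $(\widetilde{\boldsymbol u}^{n+1})_{n\ge0}$ be generated by the Crank-Nicolson scheme described in the context. Then, for every time step $\delta t>0$ (unconditionally) and every $n\ge 0$, the following discrete energy dissipation law holds: $$E^{n+1}=E^{n}-\frac{\delta t}{M}\|\dot\phi^{n+1}\|^2-\delta t\Big(\mu_1\|(\nabla\phi^{\star,n+\frac12})^TD(\widetilde{\boldsymbol u}^{n+\frac12})\nabla\phi^{\star,n+\frac12}\|^2+\mu_4\|D(\widetilde{\boldsymbol u}^{n+\frac12})\|^2+2\mu_5\|D(\widetilde{\boldsymbol u}^{n+\frac12})\nabla\phi^{\star,n+\frac12}\|^2\Big),$$ where $$E^n=\frac12\|\boldsymbol u^n\|^2+\frac K2\|\psi^n\|^2+\frac{K}{4\epsilon^2}\|U^n\|^2+\frac{\delta t^2}{8}\|\nabla p^n\|^2 .$$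
   Context: $\Omega\subset\mathbb{R}^d$, $d\in\{2,3\}$, is a bounded domain with smooth boundary and outward normal $\boldsymbol m$; $\|\cdot\|$ is the $L^2(\Omega)$ norm (of scalar, vector or matrix fields). The constants satisfy $K,M,\epsilon>0$ and $\mu_1,\mu_4,\mu_5\ge0$; $\delta t>0$ is the time step. Notation: $D(\boldsymbol{u})=\frac12(\nabla\boldsymbol{u}+\nabla\boldsymbol{u}^T)$, $B(\boldsymbol{u},\boldsymbol{v})=(\boldsymbol{u}\cdot\nabla)\boldsymbol{v}+\frac12(\nabla\cdot\boldsymbol{u})\boldsymbol{v}$, and $$\sigma(\boldsymbol{u},\phi)=\mu_1\big(\nabla\phi^TD(\boldsymbol{u})\nabla\phi\big)\nabla\phi\otimes\nabla\phi+\mu_4D(\boldsymbol{u})+\mu_5\big(D(\boldsymbol{u})\nabla\phi\otimes\nabla\phi+\nabla\phi\otimes D(\boldsymbol{u})\nabla\phi\big).$$ Crank-Nicolson scheme. Initial data: $\phi^0$ with $\partial_{\boldsymbol m}\phi^0=\partial_{\boldsymbol m}\Delta\phi^0=0$ on $\partial\Omega$, $\psi^0=-\Delta\phi^0$, $U^0=|\nabla\phi^0|^2-1$, $\boldsymbol u^0$ with $\nabla\cdot\boldsymbol u^0=0$ in $\Omega$ and $\boldsymbol u^0=0$ on $\partial\Omega$, and $p^0$; for the first step one sets $\phi^{-1}=\phi^0$, $\boldsymbol u^{-1}=\boldsymbol u^0$. For $n\ge0$ set $$\phi^{\star,n+\frac12}=\tfrac32\phi^n-\tfrac12\phi^{n-1},\quad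 \boldsymbol u^{\star,n+\frac12}=\tfrac32\boldsymbol u^n-\tfrac12\boldsymbol u^{n-1},\quad \psi^{n+\frac12}=\tfrac{\psi^{n+1}+\psi^n}2,\quad \widetilde{\boldsymbol u}^{n+\frac12}=\tfrac{\widetilde{\boldsymbol u}^{n+1}+\boldsymbol u^n}2,\quad U^{n+\frac12}=\tfrac{U^{n+1}+U^n}2,$$ $$\dot\phi^{n+1}=\frac{\phi^{n+1}-\phi^n}{\delta t}+\nabla\cdot(\widetilde{\boldsymbol u}^{n+\frac12}\phi^{\star,n+\frac12}).$$ Step 1: find $\phi^{n+1},\psi^{n+1},U^{n+1},\widetilde{\boldsymbol u}^{n+1}$ with $$\frac1M\dot\phi^{n+1}=K\Delta\psi^{n+\frac12}+\frac K{\epsilon^2}\nabla\cdot(U^{n+\frac12}\nabla\phi^{\star,n+\frac12}),\qquad \psi^{n+1}=-\Delta\phi^{n+1},$$ $$U^{n+1}-U^n=2\nabla\phi^{\star,n+\frac12}\cdot(\nabla\phi^{n+1}-\nabla\phi^n),$$ $$\frac{\widetilde{\boldsymbol u}^{n+1}-\boldsymbol u^n}{\delta t}+B(\boldsymbol u^{\star,n+\frac12},\widetilde{\boldsymbol u}^{n+\frac12})-\nabla\cdot\sigma(\widetilde{\boldsymbol u}^{n+\frac12},\phi^{\star,n+\frac12})+\nabla p^n-\frac1M\phi^{\star,n+\frac12}\nabla\dot\phi^{n+1}=0,$$ and $\widetilde{\boldsymbol u}^{n+1}=0$, $\partial_{\boldsymbol m}\phi^{n+1}=\partial_{\boldsymbol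 m}\psi^{n+1}=0$ on $\partial\Omega$. Step 2: find $\boldsymbol u^{n+1},p^{n+1}$ with $$\frac{\boldsymbol u^{n+1}-\widetilde{\boldsymbol u}^{n+1}}{\delta t}+\frac12\nabla(p^{n+1}-p^n)=0,\qquad \nabla\cdot\boldsymbol u^{n+1}=0,\qquad \boldsymbol u^{n+1}\cdot\boldsymbol m|_{\partial\Omega}=0.$$ All functions are assumed smooth on $\overline\Omega$, so that the equations hold pointwise and all integrations by parts are justified.
   Formalization: For n ≥ 1 the law is proved assuming ∫(∇·σ)·ũ^{n+1/2} = −∫σ:∇ũ^{n+1/2} at that step, with σ = σ(ũ^{n+1/2}, φ^{⋆,n+1/2}); the scheme does not ensure it, as u^n may slip tangentially on ∂Ω, and the law fails without it. *)

(* Defs.v *)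
From HB Require Import structures.
From mathcomp Require Import all_boot all_order all_algebra.
From mathcomp Require Import all_classical all_reals all_analysis.

Set Implicit Arguments.
Unset Strict Implicit.
Unset Printing Implicit Defensive.

Import Order.TTheory GRing.Theory Num.Theory.
Import numFieldNormedType.Exports.

Local Open Scope classical_set_scope.
Local Open Scope ring_scope.

(* The library has the Lebesgue measure on R and binary product measures, but
   no measure on 'rV[R]_d. The d-dimensional Lebesgue measure is the iterated
   product measure on R * (R * (... * unit)), a space identified with 'rV[R]_d
   through [eucl_row]; the record is what makes the recursion on d possible. *)
Record sfmspace (R : realType) := SFMSpace {
  sfm_disp : measure_display;
  sfm_sort : measurableType sfm_disp;
  sfm_measure : {sigma_finite_measure set sfm_sort -> \bar R} }.

(* A copy of [product_measure1] carrying the sigma-finite structure: the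
   library's own instance is masked by the one for subprobabilities. *)
Section ProdMeasure.
Context d1 d2 (T1 : measurableType d1) (T2 : measurableType d2) (R : realType).
Variable m1 : {sigma_finite_measure set T1 -> \bar R}.
Variable m2 : {sigma_finite_measure set T2 -> \bar R}.

Definition prod_measure : set (T1 * T2)%type -> \bar R := (m1 \x m2)%E.

HB.instance Definition _ := Measure.on prod_measure.

Let prod_measure_sigma_finite : sigma_finite setT prod_measure.
Proof.
have /sigma_finiteP[F [TF ndF Foo]] := sigma_finiteT m1.
have /sigma_finiteP[G [TG ndG Goo]] := sigma_finiteT m2.
exists (fun n => F n `*` G n).
  rewrite -setXTT TF TG predeqE => -[x y]; split.
    move=> [/= [n _ Fnx] [k _ Gky]]; exists (maxn n k) => //; split.
    - by move: x Fnx; exact/subsetPset/ndF/leq_maxl.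
    - by move: y Gky; exact/subsetPset/ndG/leq_maxr.
  by move=> [n _ []/= ? ?]; split; exists n.
move=> k; have [mF finF] := Foo k; have [mG finG] := Goo k.
split; first exact: measurableX.
by rewrite /prod_measure product_measure1E// lte_mul_pinfty// ge0_fin_numE.
Qed.

HB.instance Definition _ := Measure_isSigmaFinite.Build _ _ _ prod_measure
  prod_measure_sigma_finite.

End ProdMeasure.

Fixpoint eucl (R : realType) (d : nat) : sfmspace R :=
  match d with
  | 0 => @SFMSpace R _ unit (@dirac _ unit tt R)
  | d'.+1 =>
      @SFMSpace R _ (measurableTypeR R * sfm_sort (eucl R d'))%type
        (prod_measure (@lebesgue_measure R) (sfm_measure (eucl R d')))
  end.

Fixpoint eucl_row (R : realType) (d : nat) : sfm_sort (eucl R d) -> 'rV[R]_d :=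
  match d with
  | 0 => fun _ => 0
  | d'.+1 => fun z => row_mx (z.1%:M : 'rV[R]_1) (eucl_row z.2)
  end.

Definition vol_int (R : realType) (d : nat) (Omega : set 'rV[R]_d)
    (f : 'rV[R]_d -> R) : R :=
  (\int[sfm_measure (eucl R d)]_(z in @eucl_row R d @^-1` Omega)
     f (eucl_row z))%R.

Definition frob (R : realType) (m n : nat) (A : 'M[R]_(m, n)) : R :=
  Num.sqrt (\sum_i \sum_j A i j ^+ 2).

(* [L2norm] is for scalar fields, [L2norm_mx] for vector fields (m = 1) and
   matrix fields, measured pointwise in the Euclidean (Frobenius) norm; the
   library norm of 'M[R]_(m, n) is the max norm and only supplies the
   topology. *)
Definition L2norm (R : realType) (d : nat) (Omega : set 'rV[R]_d)
    (f : 'rV[R]_d -> R) : R :=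
  Num.sqrt (vol_int Omega (fun x => f x ^+ 2)).

Definition L2norm_mx (R : realType) (d m n : nat) (Omega : set 'rV[R]_d)
    (F : 'rV[R]_d -> 'M[R]_(m, n)) : R :=
  L2norm Omega (fun x => frob (F x)).

Section Calculus.
Context {R : realType} {d : nat}.
Local Notation vec := 'rV[R]_d.

Definition partial (i : 'I_d) (f : vec -> R) (x : vec) : R :=
  'D_(delta_mx 0 i : vec) f x.

Definition iter_partial (s : seq 'I_d) (f : vec -> R) : vec -> R :=
  foldr partial f s.

(* C^infinity on the open set V *)
Definition smooth_on (V : set vec) (f : vec -> R) : Prop :=
  forall (s : seq 'I_d) (x : vec), V x -> differentiable (iter_partial s f) x.

(* C^infinity up to the boundary: f is smooth on an open neighbourhood of the
   closure. This gives a meaning to derivatives at boundary points, and their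
   values there are determined by the restriction of f to a smooth Omega. *)
Definition smooth_closure (Omega : set vec) (f : vec -> R) : Prop :=
  exists V : set vec, [/\ open V, closure Omega `<=` V & smooth_on V f].

Definition component (u : vec -> vec) (i : 'I_d) (x : vec) : R := u x 0 i.

Definition smooth_closure_vec (Omega : set vec) (u : vec -> vec) : Prop :=
  forall i, smooth_closure Omega (component u i).

Definition dot (a b : vec) : R := \sum_i a 0 i * b 0 i.
Definition outer (a b : vec) : 'M[R]_d := a^T *m b.
Definition mxapp (A : 'M[R]_d) (a : vec) : vec := a *m A^T.

Definition grad (f : vec -> R) (x : vec) : vec := \row_i partial i f x.
Definition divergence (u : vec -> vec) (x : vec) : R :=
  \sum_i partial i (component u i) x.
Definition laplacian (f : vec -> R) : vec -> R := divergence (grad f).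
(* (nabla u)_ij = d_j u_i *)
Definition gradv (u : vec -> vec) (x : vec) : 'M[R]_d :=
  \matrix_(i, j) partial j (component u i) x.
Definition symgrad (u : vec -> vec) (x : vec) : 'M[R]_d :=
  2^-1 *: (gradv u x + (gradv u x)^T).
Definition divergence_mx (S : vec -> 'M[R]_d) (x : vec) : vec :=
  \row_i \sum_j partial j (fun y => S y i j) x.

(* B(u, v) = (u . nabla) v + (div u) v / 2 *)
Definition Bform (u v : vec -> vec) (x : vec) : vec :=
  mxapp (gradv v x) (u x) + (2^-1 * divergence u x) *: v x.

End Calculus.

Section Domain.
Context {R : realType} {d : nat}.
Local Notation vec := 'rV[R]_d.

Definition boundary (A : set vec) : set vec := closure A `\` A°.

Definition local_defining (Omega : set vec) (x : vec) (V : set vec)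
    (rho : vec -> R) : Prop :=
  [/\ open V, V x, smooth_on V rho,
      forall y, V y -> grad rho y != 0
    & forall y, V y -> (Omega y <-> rho y < 0)].

(* Omega lies locally on one side of a smooth hypersurface. *)
Definition smooth_boundary (Omega : set vec) : Prop :=
  forall x, boundary Omega x -> exists V rho, local_defining Omega x V rho.

Definition bounded_smooth_domain (Omega : set vec) : Prop :=
  [/\ Omega !=set0, open Omega, connected Omega, bounded_set Omega
    & smooth_boundary Omega].

Definition outward_unit_normal (Omega : set vec) (m : vec -> vec) : Prop :=
  forall x, boundary Omega x ->
    exists V rho, local_defining Omega x V rho /\
      m x = (frob (grad rho x))^-1 *: grad rho x.

(* int_Omega (div S) . v = - int_Omega S : grad v *)
Definition ibp_justified (Omega : set vec) (S : vec -> 'M[R]_d)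
    (v : vec -> vec) : Prop :=
  vol_int Omega (fun x => dot (divergence_mx S x) (v x)) =
  - vol_int Omega (fun x => \sum_i \sum_j S x i j * gradv v x i j).

End Domain.

Record cn_params (R : realType) := CNParams {
  elastK : R; mobM : R; eps : R; mu1 : R; mu4 : R; mu5 : R; dt : R }.

Definition cn_params_ok (R : realType) (c : cn_params R) : Prop :=
  [/\ 0 < elastK c, 0 < mobM c & 0 < eps c] /\
  [/\ 0 <= mu1 c, 0 <= mu4 c, 0 <= mu5 c & 0 < dt c].

(* [ut n.+1] is the intermediate velocity of step n; [ut 0] is never used. *)
Record cn_iterates (R : realType) (d : nat) := CNIterates {
  phi : nat -> 'rV[R]_d -> R;
  psi : nat -> 'rV[R]_d -> R;
  auxU : nat -> 'rV[R]_d -> R;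
  vel : nat -> 'rV[R]_d -> 'rV[R]_d;
  pres : nat -> 'rV[R]_d -> R;
  ut : nat -> 'rV[R]_d -> 'rV[R]_d }.

Section Scheme.
Context {R : realType} {d : nat}.
Local Notation vec := 'rV[R]_d.
Variables (c : cn_params R) (s : cn_iterates R d).

Definition sigma (u : vec -> vec) (f : vec -> R) (x : vec) : 'M[R]_d :=
  let g := grad f x in
  let Dg := mxapp (symgrad u x) g in
  (mu1 c * dot g Dg) *: outer g g + mu4 c *: symgrad u x +
  mu5 c *: (outer Dg g + outer g Dg).

(* Extrapolations: 0.-1 = 0, which is the convention phi^{-1} = phi^0 and
   u^{-1} = u^0. *)
Definition phi_star (n : nat) (x : vec) : R :=
  3 / 2 * phi s n x - 2^-1 * phi s n.-1 x.
Definition vel_star (n : nat) (x : vec) : vec :=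
  (3 / 2) *: vel s n x - 2^-1 *: vel s n.-1 x.

Definition psi_half (n : nat) (x : vec) : R := (psi s n.+1 x + psi s n x) / 2.
Definition U_half (n : nat) (x : vec) : R := (auxU s n.+1 x + auxU s n x) / 2.
Definition ut_half (n : nat) (x : vec) : vec :=
  2^-1 *: (ut s n.+1 x + vel s n x).

(* [phi_dot n] is the quantity indexed by n + 1 in the scheme. *)
Definition phi_dot (n : nat) (x : vec) : R :=
  (phi s n.+1 x - phi s n x) / dt c +
  divergence (fun y => phi_star n y *: ut_half n y) x.

Definition cn_smooth (Omega : set vec) : Prop :=
  forall n,
    [/\ smooth_closure Omega (phi s n), smooth_closure Omega (psi s n),
        smooth_closure Omega (auxU s n) & smooth_closure Omega (pres s n)] /\
    smooth_closure_vec Omega (vel s n) /\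
    smooth_closure_vec Omega (ut s n.+1).

Definition cn_initial (Omega : set vec) (m : vec -> vec) : Prop :=
  [/\ forall x, boundary Omega x ->
        'D_(m x) (phi s 0) x = 0 /\ 'D_(m x) (laplacian (phi s 0)) x = 0,
      forall x, Omega x -> psi s 0 x = - laplacian (phi s 0) x,
      forall x, Omega x -> auxU s 0 x = frob (grad (phi s 0) x) ^+ 2 - 1,
      forall x, Omega x -> divergence (vel s 0) x = 0
    & forall x, boundary Omega x -> vel s 0 x = 0].

Definition cn_step1_eqs (n : nat) (x : vec) : Prop :=
  [/\ (mobM c)^-1 * phi_dot n x =
        elastK c * laplacian (psi_half n) x +
        elastK c / eps c ^+ 2 *
          divergence (fun y => U_half n y *: grad (phi_star n) y) x,
      psi s n.+1 x = - laplacian (phi s n.+1) x,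
      auxU s n.+1 x - auxU s n x =
        2 * dot (grad (phi_star n) x) (grad (phi s n.+1) x - grad (phi s n) x)
    & (dt c)^-1 *: (ut s n.+1 x - vel s n x)
        + Bform (vel_star n) (ut_half n) x
        - divergence_mx (sigma (ut_half n) (phi_star n)) x
        + grad (pres s n) x
        - ((mobM c)^-1 * phi_star n x) *: grad (phi_dot n) x = 0].

Definition cn_step1_bc (m : vec -> vec) (n : nat) (x : vec) : Prop :=
  [/\ ut s n.+1 x = 0, 'D_(m x) (phi s n.+1) x = 0
    & 'D_(m x) (psi s n.+1) x = 0].

Definition cn_step2_eqs (n : nat) (x : vec) : Prop :=
  (dt c)^-1 *: (vel s n.+1 x - ut s n.+1 x)
    + 2^-1 *: grad (fun y => pres s n.+1 y - pres s n y) x = 0 /\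
  divergence (vel s n.+1) x = 0.

Definition cn_step2_bc (m : vec -> vec) (n : nat) (x : vec) : Prop :=
  dot (vel s n.+1 x) (m x) = 0.

Definition cn_scheme (Omega : set vec) (m : vec -> vec) : Prop :=
  [/\ cn_smooth Omega, cn_initial Omega m,
      forall n x, Omega x -> cn_step1_eqs n x /\ cn_step2_eqs n x
    & forall n x, boundary Omega x -> cn_step1_bc m n x /\ cn_step2_bc m n x].

Definition energy (Omega : set vec) (n : nat) : R :=
  2^-1 * L2norm_mx Omega (vel s n) ^+ 2
  + elastK c / 2 * L2norm Omega (psi s n) ^+ 2
  + elastK c / (4 * eps c ^+ 2) * L2norm Omega (auxU s n) ^+ 2
  + dt c ^+ 2 / 8 * L2norm_mx Omega (grad (pres s n)) ^+ 2.

(* On the boundary ut_half n = vel n / 2. For n = 0 it vanishes, but for n > 0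
   only its normal component does, so that the divergence theorem leaves the
   boundary integral of (sigma m) . ut_half, which no equation of the scheme
   cancels. It is the only integration by parts in the energy argument that
   smoothness and the boundary conditions do not justify. *)
Definition viscous_ibp_justified (Omega : set vec) (n : nat) : Prop :=
  ibp_justified Omega (sigma (ut_half n) (phi_star n)) (ut_half n).

End Scheme.

(* Main.v *)
Require Import Defs.
From HB Require Import structures.
From mathcomp Require Import all_boot all_order all_algebra.
From mathcomp Require Import all_classical all_reals all_analysis.
From mathcomp Require Import measurable_realfun ring lra.

Set Implicit Arguments.
Unset Strict Implicit.
Unset Printing Implicit Defensive.

Import Order.TTheory GRing.Theory Num.Theory.
Import numFieldNormedType.Exports.

Local Open Scope classical_set_scope.
Local Open Scope ring_scope.

(** The law is obtained by testing the two nonlinear equations of step 1: the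
    phase-field equation with delta t times phi-dot, the momentum equation with
    delta t times the midpoint velocity. The first right-hand side is
    W = phi-dot / M, and the transport part of phi-dot, tested with W, cancels
    the capillary force of the momentum equation. What remains of the first
    equation is the product of W with phi^{n+1} - phi^n, which the linear update
    rules for psi and U turn into differences of squares at the two time levels.
    The projection step does the same for the velocity and the pressure: since
    the midpoint velocity is (u^{n+1} + u^n)/2 + (delta t/4) grad(p^{n+1} - p^n)
    and both end velocities are orthogonal to gradients, its pairing with
    grad p^n and the kinetic energy lost in the projection together produce the
    increment of the pressure term of the energy.

    Accordingly [balance] is an identity between scalars at each point of Omega:
    the energy density increment plus the dissipation density equals a linear
    combination of expressions of the form f div F + grad f . F, plus the
    viscous expression (div sigma) . v + sigma : grad v. The theorem follows by
    integrating it, once each of these expressions has integral zero. For the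
    viscous one this is the hypothesis when n > 0, and for n = 0 the midpoint
    velocity vanishes on the boundary. For the others F is tangent to the
    boundary: F is built from velocities with zero normal component or from
    gradients with zero normal derivative.

    So the analytic core is [divergence_tangent]: if F is C^1 up to the boundary
    of a bounded smooth domain and has no normal component there, then div F has
    integral zero. As the flux is zero, cutoffs suffice and no boundary integral
    ever has to be defined. Over the whole space a derivative of a compactly
    supported function integrates to zero, by Fubini and the fundamental theorem
    of calculus ([integral_partial_cpt]); hence the claim holds for fields that
    vanish near the boundary. A field supported near a boundary point, where
    Omega = {rho < 0}, is multiplied by a cutoff chi_k depending on k rho, which
    vanishes near the boundary. The error
    grad chi_k . F is k (grad rho . F) times a bounded function supported in the
    layer where -rho is of order 1/k. As grad rho . F vanishes on the boundary
    it is at most C |rho| ([tangent_estimate]), so the error stays bounded while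
    the layer shrinks to the empty set, and dominated convergence concludes
    ([local_divergence_boundary]). Compactness of the boundary and finitely many
    bump functions give the general case. *)

(** * Dot products *)

Section DotProduct.
Context {R : realType} {d : nat}.
Local Notation vec := 'rV[R]_d.
Implicit Types a b c : vec.

Lemma dotC (a b : vec) : dot a b = dot b a.
Proof. by apply: eq_bigr => i _; rewrite mulrC. Qed.

Lemma dotDr (a b c : vec) : dot a (b + c) = dot a b + dot a c.
Proof. by rewrite /dot -big_split; apply: eq_bigr => i _; rewrite mxE mulrDr. Qed.

Lemma dotZr (a b : vec) t : dot a (t *: b) = t * dot a b.
Proof. by rewrite /dot mulr_sumr; apply: eq_bigr => i _; rewrite mxE mulrCA. Qed.

Lemma dot_gt0 (a : vec) : a != 0 -> 0 < dot a a.
Proof.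
move=> a0; rewrite lt_neqAle sumr_ge0 ?andbT; last first.
  by move=> i _; rewrite -expr2 sqr_ge0.
apply: contra a0; rewrite eq_sym psumr_eq0; last first.
  by move=> i _; rewrite -expr2 sqr_ge0.
move=> /allP H; apply/eqP/rowP => i; rewrite mxE.
by have /eqP := H i (mem_index_enum _); move/eqP; rewrite mulf_eq0 orbb => /eqP.
Qed.

Lemma dotDl a b c : dot (a + b) c = dot a c + dot b c.
Proof. by rewrite dotC dotDr !(dotC c). Qed.

Lemma dotZl a b t : dot (t *: a) b = t * dot a b.
Proof. by rewrite dotC dotZr dotC. Qed.

Lemma dotNl a b : dot (- a) b = - dot a b.
Proof. by rewrite -scaleN1r dotZl mulN1r. Qed.

Lemma dotNr a b : dot a (- b) = - dot a b.
Proof. by rewrite dotC dotNl dotC. Qed.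

Lemma dot0l b : dot (0 : vec) b = 0.
Proof. by rewrite /dot big1// => i _; rewrite mxE mul0r. Qed.

End DotProduct.

(** * Regularity of scalar fields *)

Section Regularity.
Context {R : realType} {d : nat}.
Local Notation vec := 'rV[R]_d.
Implicit Types (f g : vec -> R) (x y : vec).

(** The difference of the two functions vanishes near [x], and such a function is
    differentiable there with zero differential. *)
Lemma near_eq_differentiable f g x :
  (\forall y \near x, f y = g y) -> differentiable f x -> differentiable g x.
Proof.
move=> fg df.
pose h : vec -> R^o := g - f.
have h0 : \forall y \near x, h y = 0.
  by near=> y; rewrite /h /= fctE /= -(near fg y) ?subrr//; near: y.
have hx : h x = 0 by exact: (nbhs_singleton h0).
have near0 : \forall y \near (0 : vec), h (y + x) = 0.
  by move: h0; rewrite (near_shift 0 x); apply: filterS => y /=; rewrite subr0.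
pose z : vec -> R^o := cst 0.
have dz : 'd z x = (fun=> 0) :> (vec -> R^o) by exact: diff_cst.
have cz : continuous ('d z x) by rewrite dz; exact: cst_continuous.
have small (e : R) : 0 < e -> \forall y \near (0 : vec),
    `|h (y + x) - (h x + 0)| <= e * `|y|.
  move=> e0; apply: filterS near0 => y ->; rewrite hx addr0 subrr normr0.
  by rewrite mulr_ge0// ltW.
have D0 : 'd h x = 'd z x :> (vec -> R^o).
  by apply: diff_unique => //; apply/eqaddoP => e /small; rewrite dz.
have dh : differentiable h x.
  apply/diff_locallyP; rewrite D0; split => //.
  by apply/eqaddoP => e /small; rewrite dz.
have -> : g = f + h by rewrite /h addrC subrK.
exact: differentiableD.
Unshelve. all: by end_near. Qed.

Lemma near_all (P : set vec) x : (forall y, P y) -> \forall y \near x, P y.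
Proof. by move=> H; near=> y; exact: H.
Unshelve. all: by end_near. Qed.

Lemma near_eq_partial f g x i : (\forall y \near x, f y = g y) ->
  \forall y \near x, partial i f y = partial i g y.
Proof.
by move=> /near_join; apply: filterS => y fg; rewrite /partial (near_eq_derive _ fg).
Qed.

Lemma near_eq_continuous_at f g x : (\forall y \near x, f y = g y) ->
  {for x, continuous f} -> {for x, continuous g}.
Proof.
move=> fg cf; rewrite /prop_for /continuous_at -(nbhs_singleton fg).
exact: cvg_trans (@near_eq_cvg _ _ (nbhs x) _ f g fg) cf.
Qed.

Lemma partialE f x i : differentiable f x ->
  partial i f x = 'd f x (delta_mx 0 i).
Proof. by move=> df; rewrite /partial deriveE. Qed.

Lemma partial_derivable f x i : differentiable f x ->
  derivable f x (delta_mx 0 i).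
Proof. exact: diff_derivable. Qed.

(** Only Frechet differentiability gives this: it is what relates normal
    derivatives to the components of the gradient. *)
Lemma derive_grad f x v : differentiable f x -> 'D_v f x = dot (grad f x) v.
Proof.
move=> df; rewrite deriveE// [in LHS](row_sum_delta v) linear_sum.
by apply: eq_bigr => i _; rewrite linearZ/= mxE partialE// mulrC.
Qed.

Lemma partial_cst (a : R) x i : partial i (fun=> a) x = 0.
Proof. exact: derive_cst. Qed.

Lemma partialD f g x i : differentiable f x -> differentiable g x ->
  partial i (fun y => f y + g y) x = partial i f x + partial i g x.
Proof.
move=> df dg; rewrite /partial.
by rewrite -[fun y => _]/(f + g) deriveD//; exact: partial_derivable.
Qed.

Lemma partialM f g x i : differentiable f x -> differentiable g x ->
  partial i (fun y => f y * g y) x = f x * partial i g x + g x * partial i f x.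
Proof.
move=> df dg; rewrite /partial.
by rewrite -[fun y => _]/(f * g) deriveM//; exact: partial_derivable.
Qed.

(** The class of functions that are differentiable near [x] together with their
    partial derivatives of order at most [k]. Asking for differentiability on a
    neighbourhood makes the class depend on the germ of [f] only, and the
    recursion on [k] reduces closure properties to the rules of calculus. *)
Fixpoint regular (k : nat) (f : vec -> R) (x : vec) : Prop :=
  (\forall y \near x, differentiable f y) /\
  if k is k'.+1 then forall i, regular k' (partial i f) x else True.

Lemma regular_near_diff k f x : regular k f x -> \forall y \near x, differentiable f y.
Proof. by case: k => [|k] []. Qed.

Lemma regular_diff k f x : regular k f x -> differentiable f x.
Proof. by move=> /regular_near_diff /nbhs_singleton. Qed.

Lemma regular_cont k f x : regular k f x -> {for x, continuous f}.
Proof. by move=> /regular_diff; exact: differentiable_continuous. Qed.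

Lemma regular_partial k f x i : regular k.+1 f x -> regular k (partial i f) x.
Proof. by move=> [_]; apply. Qed.

Lemma regularW k f x : regular k.+1 f x -> regular k f x.
Proof.
elim: k f => [|k IH] f []// df H; split => // i; apply: IH; exact: H.
Qed.

Lemma near_eq_regular k f g x : (\forall y \near x, f y = g y) ->
  regular k f x -> regular k g x.
Proof.
elim: k f g => [|k IH] f g fg [df H]; split => //.
- move: (near_join fg) df; apply: filterS2 => y.
  exact: near_eq_differentiable.
- move: (near_join fg) df; apply: filterS2 => y.
  exact: near_eq_differentiable.
- by move=> i; apply: IH (H i); exact: near_eq_partial.
Qed.

Lemma regular_cst k (a : R) x : regular k (fun=> a) x.
Proof.
elim: k a => [|k IH] a.
  by split => //; apply: near_all => y; exact: differentiable_cst.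
split; first by apply: near_all => y; exact: differentiable_cst.
move=> i; apply: near_eq_regular (IH 0); apply: near_all => y.
by rewrite partial_cst.
Qed.

Lemma regularD k f g x : regular k f x -> regular k g x ->
  regular k (fun y => f y + g y) x.
Proof.
elim: k f g => [|k IH] f g [df Hf] [dg Hg]; split => //.
- by move: df dg; apply: filterS2 => y; exact: differentiableD.
- by move: df dg; apply: filterS2 => y; exact: differentiableD.
- move=> i; apply: near_eq_regular (IH _ _ (Hf i) (Hg i)).
  by move: df dg; apply: filterS2 => y fy gy; rewrite partialD.
Qed.

Lemma regularM k f g x : regular k f x -> regular k g x ->
  regular k (fun y => f y * g y) x.
Proof.
elim: k f g => [|k IH] f g rf rg.
  split => //; move: (regular_near_diff rf) (regular_near_diff rg).
  by apply: filterS2 => y; exact: differentiableM.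
have [[df Hf] [dg Hg]] := (rf, rg); split.
  by move: df dg; apply: filterS2 => y; exact: differentiableM.
move=> i.
apply: near_eq_regular (regularD (IH _ _ (regularW rf) (Hg i)) (IH _ _ (regularW rg)
  (Hf i))).
by move: df dg; apply: filterS2 => y fy gy; rewrite partialM.
Qed.

Lemma regularN k f x : regular k f x -> regular k (fun y => - f y) x.
Proof.
move=> rf; apply: near_eq_regular (regularM (regular_cst k (-1) x) rf).
by apply: near_all => y; rewrite mulN1r.
Qed.

Lemma regularB k f g x : regular k f x -> regular k g x ->
  regular k (fun y => f y - g y) x.
Proof. by move=> rf rg; apply: regularD => //; exact: regularN. Qed.

Lemma regular_sum k n (h : 'I_n -> vec -> R) x :
  (forall i, regular k (h i) x) -> regular k (fun y => \sum_i h i y) x.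
Proof.
move=> rh; elim: n h rh => [|n IH] h rh.
  apply: near_eq_regular (regular_cst k 0 x); apply: near_all => y.
  by rewrite big_ord0.
apply: near_eq_regular (regularD (rh ord0) (IH _ (fun i => rh (lift ord0 i)))).
by apply: near_all => y; rewrite big_ord_recl.
Qed.

Lemma regular_smooth_on (V : set vec) k f x : open V -> smooth_on V f -> V x ->
  regular k f x.
Proof.
move=> oV + Vx; elim: k f => [|k IH] f sf.
  by split=> //; apply: filterS (open_nbhs_nbhs (conj oV Vx)) => y; exact: (sf [::]).
split; first by apply: filterS (open_nbhs_nbhs (conj oV Vx)) => y; exact: (sf [::]).
move=> i; apply: IH => s y Vy.
by have := sf (rcons s i) y Vy; rewrite /iter_partial foldr_rcons.
Qed.

Lemma smooth_closure_regular (Omega : set vec) k f x : smooth_closure Omega f ->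
  closure Omega x -> regular k f x.
Proof. by move=> [V [oV sV sf]] /sV; exact: regular_smooth_on. Qed.

Lemma partial_sum n (f : 'I_n -> vec -> R) x j :
  (forall i, differentiable (f i) x) ->
  partial j (fun y => \sum_i f i y) x = \sum_i partial j (f i) x.
Proof.
move=> df; rewrite /partial (_ : (fun y => _) = \sum_i f i); last first.
  by apply/funext => y; rewrite fct_sumE.
by rewrite derive_sum// => i; exact: diff_derivable.
Qed.

Lemma gradD (f g : vec -> R) x : differentiable f x -> differentiable g x ->
  grad (fun y => f y + g y) x = grad f x + grad g x.
Proof. by move=> df dg; apply/rowP => i; rewrite !mxE partialD. Qed.

Lemma partialZ a (f : vec -> R) x i : differentiable f x ->
  partial i (fun y => a * f y) x = a * partial i f x.
Proof.
move=> df; have dc : differentiable (fun _ : vec => a) x by exact: differentiable_cst.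
by rewrite partialM// partial_cst mulr0 addr0.
Qed.

Lemma gradZ a (f : vec -> R) x : differentiable f x ->
  grad (fun y => a * f y) x = a *: grad f x.
Proof. by move=> df; apply/rowP => i; rewrite !mxE partialZ. Qed.

Lemma gradB (f g : vec -> R) x : differentiable f x -> differentiable g x ->
  grad (fun y => f y - g y) x = grad f x - grad g x.
Proof.
move=> df dg; rewrite -[in RHS](scaleN1r (grad g x)) -gradZ//.
have dN : differentiable (fun y => -1 * g y) x.
  by apply: differentiableM => //; exact: differentiable_cst.
by rewrite -gradD//; congr (grad _ x); apply/funext => y; rewrite mulN1r.
Qed.

Lemma partialB (f g : vec -> R) x i : differentiable f x -> differentiable g x ->
  partial i (fun y => f y - g y) x = partial i f x - partial i g x.
Proof.
by move=> df dg; have /rowP/(_ i) := gradB df dg; rewrite !mxE.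
Qed.

End Regularity.

(** * Restriction of functions to lines *)

Section Lines.
Context {R : realType} {d : nat}.
Local Notation vec := 'rV[R]_d.

(** A directional derivative only sees the restriction of the function to a line;
    this transfers derivatives along affine maps without any chain rule. *)
Lemma eq_derive_line (V W : normedModType R) (f : V -> R) (g : W -> R) a v b w :
  (forall h : R, f (h *: v + a) = g (h *: w + b)) ->
  (derivable f a v <-> derivable g b w) /\ 'D_v f a = 'D_w g b.
Proof.
move=> fg; have fgab : f a = g b by have := fg 0; rewrite !scale0r !add0r.
rewrite /derivable /derive /= (_ : (fun h => _) =
  (fun h => h^-1 *: (g (h *: w + b) - g b)))//.
by apply/funext => h; rewrite /= fg fgab.
Qed.

Lemma is_derive_line (f : vec -> R) (x v : vec) (t : R) :
  differentiable f (x + t *: v) ->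
  is_derive t 1 (fun u : R => f (x + u *: v)) (dot (grad f (x + t *: v)) v).
Proof.
move=> df.
have [H1 H2] : (derivable (fun u : R => f (x + u *: v)) t 1 <->
    derivable f (x + t *: v) v) /\
    'D_1 (fun u : R => f (x + u *: v)) t = 'D_v f (x + t *: v).
  apply: eq_derive_line => h; congr f.
  by rewrite scalerDl /GRing.scale/= mulr1 addrCA.
split; first by apply/H1; exact: diff_derivable.
by rewrite H2 derive_grad.
Qed.

Lemma line_growth (f : vec -> R) (x N : vec) (a b c : R) : a <= b ->
  (forall t, a <= t <= b -> differentiable f (x + t *: N) /\
     c <= dot (grad f (x + t *: N)) N) ->
  c * (b - a) <= f (x + b *: N) - f (x + a *: N).
Proof.
move=> ab H.
have dl t : t \in `[a, b]%R -> is_derive t 1 (fun u : R => f (x + u *: N))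
    (dot (grad f (x + t *: N)) N).
  by rewrite in_itv/= => /H[df _]; exact: is_derive_line.
have dlo t : t \in `]a, b[%R -> is_derive t 1 (fun u : R => f (x + u *: N))
    (dot (grad f (x + t *: N)) N).
  by move=> /subset_itv_oo_cc; exact: dl.
have cl : {within `[a, b], continuous (fun u : R => f (x + u *: N))}.
  by apply: derivable_within_continuous => t /dl [].
have [t tab ->] := MVT_segment ab dlo cl.
by rewrite ler_wpM2r ?subr_ge0//; move: tab; rewrite in_itv/= => /H[].
Qed.

Lemma line_lipschitz (f : vec -> R) (x N : vec) (b L : R) : 0 <= b ->
  (forall t, 0 <= t <= b -> differentiable f (x + t *: N) /\
     `|dot (grad f (x + t *: N)) N| <= L) ->
  `|f (x + b *: N) - f x| <= L * b.
Proof.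
move=> b0 H.
have dl t : t \in `[0, b]%R -> is_derive t 1 (fun u : R => f (x + u *: N))
    (dot (grad f (x + t *: N)) N).
  by rewrite in_itv/= => /H[df _]; exact: is_derive_line.
have dlo t : t \in `]0, b[%R -> is_derive t 1 (fun u : R => f (x + u *: N))
    (dot (grad f (x + t *: N)) N).
  by move=> /subset_itv_oo_cc; exact: dl.
have cl : {within `[0, b], continuous (fun u : R => f (x + u *: N))}.
  by apply: derivable_within_continuous => t /dl [].
have := MVT_segment b0 dlo cl; rewrite scale0r addr0 subr0 => -[t tab ->].
rewrite normrM (ger0_norm b0) ler_wpM2r//.
by move: tab; rewrite in_itv/= => /H[].
Qed.

(** The kernel of a half-space comparison: if [f] decreases in the direction [w],
    then the points [y + h w] with small positive [h] lie in the set where [f] is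
    negative, so that [g] cannot increase in that direction. *)
Lemma derive_sign (f g : vec -> R) (y w : vec) :
  differentiable f y -> differentiable g y -> f y = 0 -> g y = 0 ->
  (\forall z \near y, f z < 0 -> g z < 0) ->
  dot (grad f y) w < 0 -> dot (grad g y) w <= 0.
Proof.
move=> df dg f0 g0 fg; rewrite -!derive_grad// => fw.
have quot (k : vec -> R) : differentiable k y -> k y = 0 ->
    (h^-1 * k (h *: w + y)) @[h --> (0 : R)^'+] --> 'D_w k y.
  move=> dk k0.
  have kd : derivable k y w by exact: diff_derivable.
  have := cvg_dnbhs_at_right kd; apply: cvg_trans; apply: near_eq_cvg.
  by near=> h; rewrite /= k0 subr0.
rewrite leNgt; apply/negP => gw.
have line : \forall h \near (0 : R)^'+, f (h *: w + y) < 0 -> g (h *: w + y) < 0.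
  have lc : (h *: w + y) @[h --> (0 : R)^'+] --> y.
    rewrite -[X in _ --> X](add0r y) -(scale0r w).
    apply: cvgD; last exact: cvg_cst.
    by apply: cvgZr_tmp; apply: cvg_at_right_filter; exact: cvg_id.
  exact: lc fg.
have fq : \forall h \near (0 : R)^'+, h^-1 * f (h *: w + y) < 0.
  exact: cvgr_lt (quot f df f0) _ fw.
have gq : \forall h \near (0 : R)^'+, 0 < h^-1 * g (h *: w + y).
  exact: cvgr_gt (quot g dg g0) _ gw.
have pos : \forall h \near (0 : R)^'+, 0 < h by exact: nbhs_right_gt.
have [h [[hf hg] [hp hl]]] := filter_ex (filterI (filterI fq gq) (filterI pos line)).
have : g (h *: w + y) < 0.
  by apply: hl; move: hf; rewrite pmulr_rlt0 ?invr_gt0.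
by move: hg; rewrite pmulr_rgt0 ?invr_gt0// => /lt_trans/[apply]; rewrite ltxx.
Unshelve. all: by end_near. Qed.

End Lines.

(** * Continuity and coordinates *)

Section ContinuityTools.
Context {R : realType} {d : nat}.
Local Notation vec := 'rV[R]_d.

Lemma eq_continuous_at (T U : topologicalType) (f g : T -> U) x :
  f =1 g -> {for x, continuous f} -> {for x, continuous g}.
Proof. by move=> /funext ->. Qed.

Lemma continuous_near_lt (f : vec -> R) x a : {for x, continuous f} -> f x < a ->
  \forall y \near x, f y < a.
Proof. by move=> cf fa; have := lt_nbhsl fa; exact: cf. Qed.

Lemma continuous_near_gt (f : vec -> R) x a : {for x, continuous f} -> a < f x ->
  \forall y \near x, a < f y.
Proof. by move=> cf fa; have := lt_nbhsr fa; exact: cf. Qed.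

Lemma continuous_at_sum n (f : 'I_n -> vec -> R) x :
  (forall i, {for x, continuous (f i)}) ->
  {for x, continuous (fun y => \sum_i f i y)}.
Proof.
elim: n f => [|n IH] f cf.
  apply: (@eq_continuous_at _ _ (fun=> 0)) => [y|]; first by rewrite big_ord0.
  exact: cst_continuous.
apply: (@eq_continuous_at _ _ (fun y => f ord0 y + \sum_i f (lift ord0 i) y)).
  by move=> y; rewrite big_ord_recl.
by apply: continuousD => //; exact: IH.
Qed.

Lemma vec_norm_coord (x : vec) i : `|x 0 i| <= `|x|.
Proof.
apply/ler_addgt0Pr => e e0.
have : ball_ (fun z : vec => `|z|) 0 (`|x| + e) x.
  by rewrite /ball_/= sub0r normrN ltrDl.
rewrite -mx_norm_ball => -[_ /(_ 0 i)]; rewrite mxE -ball_normE/= sub0r normrN.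
exact: ltW.
Qed.

Lemma partial_coord i j (x : vec) :
  partial j (fun y => y 0 i) x = (delta_mx 0 j : vec) 0 i.
Proof.
pose v := (delta_mx 0 j : vec) 0 i.
have D : is_derive (0 : R) 1 ((v \*: (id : R -> R)) + cst (x 0 i)) v.
  by apply: is_derive_eq; rewrite addr0 /GRing.scale/= mulr1.
have Dv : 'D_1 ((v \*: (id : R -> R)) + cst (x 0 i)) (0 : R) = v by have [_ ->] := D.
rewrite -[RHS]/v -Dv; apply: (eq_derive_line _).2 => h.
by rewrite !fctE /v !mxE /GRing.scale/= addr0 mulr1 [h * _]mulrC.
Qed.

End ContinuityTools.

(** * A smooth step *)

Section StepFunction.
Context {R : realType}.
Implicit Types t : R.

(** The simplest C^1 function that vanishes exactly for [t <= 0];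
    composing it twice gives an explicit C^1 transition from 0 to 1. *)
Definition sqpos t : R := Num.max t 0 ^+ 2.

Lemma is_derive_sqpos t : is_derive t 1 sqpos (2 * Num.max t 0).
Proof.
have [t0|t0|->] := ltgtP t 0.
- rewrite mulr0; apply: (near_eq_is_derive (f := cst 0)).
    near=> u; rewrite /sqpos max_r ?expr0n//.
    by apply: ltW; near: u; exact: lt_nbhsl.
- apply: (near_eq_is_derive (f := fun u : R => u ^+ 2)).
    near=> u; rewrite /sqpos max_l//.
    by apply: ltW; near: u; exact: lt_nbhsr.
  have -> : (fun u : R => u ^+ 2) = (id : R -> R) ^+ 2 by apply/funext => u;
    rewrite exprfctE.
  apply: is_derive_eq; rewrite /GRing.scale/= expr1 mulr1.
  by rewrite mulr_natl.
- rewrite mulr0.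
  have lim0 : h^-1 *: (sqpos (h *: 1 + 0) - sqpos 0) @[h --> 0^'] --> (0 : R).
    apply/cvgrPdist_le => e e0; near=> h.
    rewrite /sqpos maxxx expr0n subr0 sub0r normrN addr0 /GRing.scale/= mulr1.
    have h0 : h != 0 by near: h; exact: nbhs_dnbhs_neq.
    have he : `|h| <= e by near: h; exact: dnbhs0_le.
    apply: le_trans he; rewrite normrM normfV ler_pdivrMl ?normr_gt0//.
    rewrite normrX -expr2 ler_sqr ?nnegrE//.
    by have [hn|hp] := leP h 0; rewrite ?normr0.
  split; first by apply/cvg_ex; exists 0; exact: lim0.
  exact: cvg_lim lim0.
Unshelve. all: by end_near. Qed.

Definition step t : R := 1 - sqpos (1 - sqpos t).
Definition dstep t : R := 4 * Num.max (1 - sqpos t) 0 * Num.max t 0.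

Lemma is_derive_step t : is_derive t 1 step (dstep t).
Proof.
have d1 := is_derive_sqpos t.
have d2 : is_derive t 1 (fun u => 1 - sqpos u) (- (2 * Num.max t 0)).
  by have := is_deriveB (is_derive_cst (1 : R) t 1) d1; rewrite sub0r.
have d3 := is_derive_sqpos (1 - sqpos t).
have d4 := @is_derive1_comp _ sqpos (fun u => 1 - sqpos u) _ _ _ d3 d2.
have -> : step = cst 1 - (sqpos \o (fun u => 1 - sqpos u)) by [].
apply: is_derive_eq; rewrite /dstep.
by rewrite sub0r /GRing.scale/=; ring.
Qed.

Lemma step_le0 t : t <= 0 -> step t = 0.
Proof.
move=> t0; rewrite /step /sqpos (max_r t0) expr0n subr0 max_l ?ler01//.
by rewrite expr1n subrr.
Qed.

Lemma step_ge1 t : 1 <= t -> step t = 1.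
Proof.
move=> t1; have t0 : 0 <= t by exact: le_trans t1.
by rewrite /step /sqpos (max_l t0) max_r ?subr_le0 ?exprn_ege1// expr0n subr0.
Qed.

Lemma dstep_le0 t : t <= 0 -> dstep t = 0.
Proof. by move=> t0; rewrite /dstep (max_r t0) mulr0. Qed.

Lemma dstep_ge1 t : 1 <= t -> dstep t = 0.
Proof.
move=> t1; have t0 : 0 <= t by exact: le_trans t1.
rewrite /dstep [sqpos t]/sqpos (max_l t0) max_r ?mulr0 ?mul0r//.
by rewrite subr_le0 exprn_ege1.
Qed.

Lemma step_bound t : `|step t| <= 1.
Proof.
have q0 u : 0 <= sqpos u by exact: sqr_ge0.
have q1 : sqpos (1 - sqpos t) <= 1.
  rewrite /sqpos expr_le1// ?le_max ?lexx ?orbT// ge_max ler01 andbT.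
  by rewrite gerBl; exact: q0.
by rewrite ler_norml /step; have := q0 (1 - sqpos t); move: q1; lra.
Qed.

Lemma dstep_bound t : `|dstep t| <= 4.
Proof.
have [t0|t0] := leP t 0; first by rewrite dstep_le0// normr0.
have [t1|t1] := leP 1 t; first by rewrite dstep_ge1// normr0.
have s0 : 0 <= sqpos t by exact: sqr_ge0.
have m0 : 0 <= Num.max (1 - sqpos t) 0 <= 1.
  by rewrite le_max lexx orbT/= ge_max ler01 andbT gerBl.
rewrite /dstep (max_l (ltW t0)); case/andP: m0 => m0 m1.
by rewrite ger0_norm; nra.
Qed.

Lemma continuous_dstep : continuous dstep.
Proof.
have cm (f : R -> R) t : {for t, continuous f} ->
    {for t, continuous (fun u => Num.max (f u) 0)}.
  by move=> cf; apply: continuous_max => //; exact: cst_continuous.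
have cs : continuous sqpos.
  move=> t; apply: differentiable_continuous; apply/derivable1_diffP.
  by have [] := is_derive_sqpos t.
move=> t.
have C1 : {for t, continuous (fun u => Num.max (1 - sqpos u) 0)}.
  by apply: cm; apply: continuousB; [exact: cst_continuous|exact: cs].
have c2 : {for t, continuous (fun u : R => Num.max u 0)}.
  by apply: (cm id); exact: cvg_id.
have c4 : {for t, continuous (fun _ : R => 4 : R)} by exact: cvg_cst.
have c41 := continuousM c4 C1.
exact: continuousM c41 c2.
Qed.

End StepFunction.

(** * Continuously differentiable fields *)

Section ContinuouslyDifferentiable.
Context {R : realType} {d : nat}.
Local Notation vec := 'rV[R]_d.
Implicit Types (f g : vec -> R) (x y : vec).

(** The regularity of the cutoff functions used below, which is also all that the
    divergence theorem asks of a vector field. *)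
Definition C1 f x := (\forall y \near x, differentiable f y) /\
  forall i, {for x, continuous (partial i f)}.

Lemma regular_C1 k f x : regular k.+1 f x -> C1 f x.
Proof. by move=> [df H]; split => // i; exact: regular_cont (H i). Qed.

Lemma C1_diff f x : C1 f x -> differentiable f x.
Proof. by move=> [/nbhs_singleton]. Qed.

Lemma C1_cont f x : C1 f x -> {for x, continuous f}.
Proof. by move=> /C1_diff; exact: differentiable_continuous. Qed.

Lemma near_eq_C1 f g x : (\forall y \near x, f y = g y) -> C1 f x -> C1 g x.
Proof.
move=> fg [df cf]; split.
  by move: (near_join fg) df; apply: filterS2 => y; exact: near_eq_differentiable.
by move=> i; apply: near_eq_continuous_at (cf i); exact: near_eq_partial.
Qed.

Lemma C1_cst (a : R) x : C1 (fun=> a) x.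
Proof. exact: regular_C1 (regular_cst 1 a x). Qed.

Lemma C1D f g x : C1 f x -> C1 g x -> C1 (fun y => f y + g y) x.
Proof.
move=> [df cf] [dg cg]; split.
  by move: df dg; apply: filterS2 => y; exact: differentiableD.
move=> i; apply: near_eq_continuous_at (continuousD (cf i) (cg i)).
by move: df dg; apply: filterS2 => y fy gy; rewrite partialD.
Qed.

Lemma C1M f g x : C1 f x -> C1 g x -> C1 (fun y => f y * g y) x.
Proof.
move=> hf hg; have [[df cf] [dg cg]] := (hf, hg); split.
  by move: df dg; apply: filterS2 => y; exact: differentiableM.
move=> i; apply: near_eq_continuous_at
  (continuousD (continuousM (C1_cont hf) (cg i)) (continuousM (C1_cont hg) (cf i))).
by move: df dg; apply: filterS2 => y fy gy; rewrite partialM.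
Qed.

Lemma differentiable_step t : differentiable (@step R) t.
Proof. by apply/derivable1_diffP; have [] := is_derive_step t. Qed.

Lemma partial_step f x i : differentiable f x ->
  partial i (fun y => step (f y)) x = dstep (f x) * partial i f x.
Proof.
move=> df; have dS := differentiable_step (f x).
rewrite (partialE _ df) partialE; last exact: differentiable_comp.
rewrite -[fun y => _]/(step \o f) diff_comp//= deriv1E; last first.
  by apply/derivable1_diffP.
by rewrite derive1E; have [_ ->] := is_derive_step (f x); rewrite mulrC.
Qed.

Lemma C1_step f x : C1 f x -> C1 (fun y => step (f y)) x.
Proof.
move=> hf; have [df cf] := hf; split.
  apply: filterS df => y dfy.
  by apply: (differentiable_comp dfy); exact: differentiable_step.
have cS : {for x, continuous (fun y => dstep (f y))}.
  by apply: continuous_comp (C1_cont hf) _; exact: continuous_dstep.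
move=> i; apply: near_eq_continuous_at (continuousM cS (cf i)).
by apply: filterS df => y dfy; rewrite partial_step.
Qed.

Lemma C1_sum n (h : 'I_n -> vec -> R) x :
  (forall i, C1 (h i) x) -> C1 (fun y => \sum_i h i y) x.
Proof.
move=> rh; elim: n h rh => [|n IH] h rh.
  by apply: near_eq_C1 (C1_cst 0 x); apply: near_all => y; rewrite big_ord0.
apply: near_eq_C1 (C1D (rh ord0) (IH _ (fun i => rh (lift ord0 i)))).
by apply: near_all => y; rewrite big_ord_recl.
Qed.

Lemma C1_dot_grad (f : vec -> R) (N : vec) x : C1 f x ->
  {for x, continuous (fun y => dot (grad f y) N)}.
Proof.
move=> [_ cf]; apply: (@eq_continuous_at _ _ (fun y => \sum_i partial i f y * N 0 i)).
  by move=> y; apply: eq_bigr => i _; rewrite mxE.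
apply: continuous_at_sum => i; apply: continuousM; last exact: cst_continuous.
exact: cf.
Qed.

End ContinuouslyDifferentiable.

(** * Measurability and integrability in R^d *)

Section EuclMeasure.
Context {R : realType}.

Lemma eucl_row_ord0 d (z : sfm_sort (eucl R d.+1)) : eucl_row z 0 ord0 = z.1.
Proof.
rewrite /= mxE; case: splitP => [j _|k /= //].
by rewrite mxE !ord1.
Qed.

Lemma eucl_row_lift d (z : sfm_sort (eucl R d.+1)) j :
  eucl_row z 0 (lift ord0 j) = eucl_row z.2 0 j.
Proof.
rewrite /= mxE; case: splitP => [k /= jk|k /= [jk]].
  by have := ltn_ord k; rewrite -jk.
by congr (_ 0 _); apply: val_inj; move: jk; rewrite !add0n.
Qed.

Lemma measurable_eucl_row_coord d (i : 'I_d) :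
  measurable_fun setT (fun z : sfm_sort (eucl R d) => eucl_row z 0 i).
Proof.
elim: d i => [[]//|d IH] i; have [j ->|->] := unliftP ord0 i.
  rewrite (_ : (fun z => _) =
    (fun z : sfm_sort (eucl R d) => eucl_row z 0 j) \o snd); last first.
    by apply/funext => z; rewrite eucl_row_lift.
  exact: measurableT_comp (IH j) measurable_snd.
rewrite (_ : (fun z => _) = fst); first exact: measurable_fst.
by apply/funext => z; rewrite eucl_row_ord0.
Qed.

Lemma measurable_eucl_coords d (A : 'I_d -> set R) :
  (forall i, measurable (A i)) ->
  measurable [set z : sfm_sort (eucl R d) | forall i, A i (eucl_row z 0 i)].
Proof.
move=> mA.
rewrite (_ : [set z | _] = \bigcap_(i in [set: 'I_d])
    ((fun z => eucl_row z 0 i) @^-1` A i)).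
  apply: fin_bigcap_measurable => // i _; rewrite -[X in measurable X]setTI.
  exact: (measurable_eucl_row_coord i measurableT (mA i)).
by apply/seteqP; split => z H i; [move=> _|]; exact: H.
Qed.

Lemma measurable_eucl_ball d (a : 'rV[R]_d) r : 0 < r ->
  measurable (@eucl_row R d @^-1` ball a r).
Proof.
move=> r0; rewrite (_ : _ @^-1` _ =
    [set z | forall i, ball (a 0 i) r (eucl_row z 0 i)]).
  apply: (measurable_eucl_coords (A := fun i => ball (a 0 i) r)) => i.
  exact: measurable_ball.
apply/seteqP; split => z; first by move=> [_ H] i; exact: H.
by move=> H; split => // i j; rewrite ord1; exact: H.
Qed.

(** An open set is the union of the
    rational balls that it contains, which are countably many, and the preimage
    of a ball is a finite intersection of coordinate conditions. *)
Lemma measurable_eucl_open d (U : set 'rV[R]_d) : open U ->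
  measurable (@eucl_row R d @^-1` U).
Proof.
move=> oU.
pose rad (k : nat) : R := k.+1%:R^-1.
pose bl (p : 'rV[rat]_d * nat) : set 'rV[R]_d := ball (map_mx ratr p.1 : 'rV[R]_d) (rad
  p.2).
pose P := [set p | bl p `<=` U].
have -> : U = \bigcup_(p in P) bl p.
  apply/seteqP; split; last by move=> x [p Pp]; exact: Pp.
  move=> x Ux; have /nbhs_ballP[e /= e0 xe] := open_nbhs_nbhs (conj oU Ux).
  have [k ke] : exists k, rad k + rad k <= e.
    near \oo => k; exists k.
    have : rad k < e / 2.
      by near: k; apply: (near_infty_natSinv_lt (PosNum (divr_gt0 e0 _))).
    by lra.
  have rk : 0 < rad k by rewrite invr_gt0.
  (* The centre of a rational ball that contains x and is contained in the given ball. *)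
have ex i : exists q : rat, `|x 0 i - ratr q| < rad k.
    have /rat_in_itvoo[q] : x 0 i - rad k < x 0 i + rad k by lra.
    rewrite in_itv/= => /andP[q1 q2]; exists q.
    by rewrite ltr_norml; apply/andP; split; lra.
  have [q hq] := choice ex.
  have bq : ball (map_mx ratr (\row_i q i) : 'rV[R]_d) (rad k) x.
    by split => // i j; rewrite ord1 !mxE; apply: ball_sym; exact: hq.
  exists (\row_i q i, k) => //= y hy; apply: xe.
  apply: le_ball ke _ _; apply: ball_triangle hy.
  exact: ball_sym.
rewrite preimage_bigcup.
pose F n := if unpickle n is Some p then
  (if `[< P p >] then @eucl_row R d @^-1` bl p else set0) else set0.
rewrite (_ : \bigcup_(p in P) _ = \bigcup_n F n).
  apply: bigcupT_measurable => n; rewrite /F.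
  case: unpickle => [p|]; last exact: measurable0.
  case: ifP => _; last exact: measurable0.
  by apply: measurable_eucl_ball; rewrite invr_gt0.
apply/seteqP; split => z.
  move=> [p Pp pz]; exists (pickle p) => //; rewrite /F pickleK.
  by rewrite asboolT.
move=> [n _]; rewrite /F; case: unpickle => [p|//].
by case: asboolP => // Pp pz; exists p.
Unshelve. all: by end_near. Qed.

Lemma measurable_eucl_continuous d (O : set 'rV[R]_d) (f : 'rV[R]_d -> R) :
  open O -> (forall x, O x -> {for x, continuous f}) ->
  measurable_fun (@eucl_row R d @^-1` O) (fun z => f (eucl_row z)).
Proof.
move=> oO cf; apply: (measurability _ (RGenOpens.measurableE R)).
move=> _ [_ [a [b ->] <-]].
rewrite -[X in measurable X]/(@eucl_row R d @^-1` (O `&` f @^-1` `]a, b[)).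
apply: measurable_eucl_open; rewrite openE => x [Ox fx].
apply: filterI; first exact: open_nbhs_nbhs.
by apply: (cf x Ox); apply: open_nbhs_nbhs; split => //; exact: interval_open.
Qed.

Lemma measurable_eucl_box d (r : R) :
  measurable [set z : sfm_sort (eucl R d) | forall i, `|eucl_row z 0 i| <= r].
Proof.
rewrite (_ : [set z | _] =
    [set z | forall i, `[(- r), r]%classic (eucl_row z 0 i)]).
  exact: (measurable_eucl_coords (A := fun=> `[(- r), r]%classic)).
by apply/seteqP; split => z H i; have := H i; rewrite /= in_itv/= ler_norml.
Qed.

Lemma eucl_box_finite d (r : R) : (sfm_measure (eucl R d)
  [set z | forall i, `|eucl_row z 0 i| <= r]%R < +oo)%E.
Proof.
elim: d => [|d IH].
  rewrite (_ : [set z | _] = setT); first by rewrite /= diracT ltry.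
  by apply/seteqP; split => // z _ [].
rewrite (_ : [set z | _] = `[(- r), r] `*`
    [set z : sfm_sort (eucl R d) | forall i, `|eucl_row z 0 i| <= r]%R).
  rewrite /= /prod_measure product_measure1E//; last first.
    exact: measurable_eucl_box.
  have fin : lebesgue_measure `[(- r)%R, r]%classic \is a fin_num.
    by rewrite (@lebesgue_measure_itv R `[(- r)%R, r])/=; case: ifP.
  exact: lte_mul_pinfty.
apply/seteqP; split => z.
  move=> H; split; first by rewrite /= in_itv/= -ler_norml -eucl_row_ord0.
  by move=> i; rewrite -eucl_row_lift.
move=> [/= + H2]; rewrite in_itv/= -ler_norml => H1 i.
have [j ->|->] := unliftP ord0 i; first by rewrite eucl_row_lift.
by rewrite eucl_row_ord0.
Qed.

Lemma eucl_integrable d (O : set 'rV[R]_d) (f : 'rV[R]_d -> R) (r C : R) :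
  open O -> (forall x, O x -> forall i, `|x 0 i| <= r) ->
  (forall x, O x -> {for x, continuous f}) ->
  (forall x, O x -> `|f x| <= C) ->
  (sfm_measure (eucl R d)).-integrable (@eucl_row R d @^-1` O)
    (EFin \o (fun z => f (eucl_row z))).
Proof.
move=> oO bO cf bf; apply: measurable_bounded_integrable.
- exact: measurable_eucl_open.
- apply: le_lt_trans (eucl_box_finite d r); apply: le_measure.
  + by rewrite inE; exact: measurable_eucl_open.
  + by rewrite inE; exact: measurable_eucl_box.
  + by move=> z /bO.
- exact: measurable_eucl_continuous.
- exists C; split; rewrite ?num_real// => M CM z Oz.
  by apply: le_trans (ltW CM); exact: bf.
Qed.

End EuclMeasure.

(** * Integrals of derivatives over the whole space *)

Section WholeSpace.
Context {R : realType}.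

Lemma row_mx_delta0 d (t h : R) (v : 'rV[R]_d) :
  row_mx ((h + t)%:M : 'rV[R]_1) v =
  h *: (delta_mx 0 ord0 : 'rV[R]_d.+1) + row_mx (t%:M : 'rV[R]_1) v.
Proof.
apply/rowP => j; rewrite !mxE; have [k ->|->] := unliftP ord0 j.
  case: splitP => [l|l] /= E; last by rewrite mulr0 add0r.
  by have := ltn_ord l; rewrite -E.
case: splitP => [l _|//]; rewrite !mxE !ord1 !eqxx/= mulr1 !mulr1n.
by [].
Qed.

Lemma row_mx_delta_lift d (t h : R) (v : 'rV[R]_d) (j : 'I_d) :
  row_mx (t%:M : 'rV[R]_1) (h *: (delta_mx 0 j : 'rV[R]_d) + v) =
  h *: (delta_mx 0 (lift ord0 j) : 'rV[R]_d.+1) + row_mx (t%:M : 'rV[R]_1) v.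
Proof.
apply/rowP => k; rewrite !mxE; have [l ->|->] := unliftP ord0 k.
  case: splitP => [m|m] /= E; first by have := ltn_ord m; rewrite -E.
  have -> : l = m by apply: val_inj; by case: E.
  by rewrite !mxE (inj_eq (@lift_inj _ _)).
by case: splitP => [l _|//]; rewrite mulr0 add0r.
Qed.

Lemma continuous_rV (T : topologicalType) d (f : T -> 'rV[R]_d) x :
  (forall j, {for x, continuous (fun y => f y 0 j)}) -> {for x, continuous f}.
Proof.
move=> cf P [Q hQ QP].
have H : \forall y \near x, forall j, Q 0 j (f y 0 j).
  by apply: (@filter_forall _ _ _ (nbhs x)) => j; apply: cf; exact: hQ.
by apply: filterS H => y Hy; apply: QP => i j; rewrite ord1; exact: Hy.
Qed.

Lemma row_mx_ord0 d (t : R) (v : 'rV[R]_d) :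
  (row_mx (t%:M : 'rV[R]_1) v : 'rV[R]_d.+1) 0 ord0 = t.
Proof. by rewrite mxE; case: splitP => // l _; rewrite mxE !ord1 eqxx mulr1n. Qed.

Lemma row_mx_lift d (t : R) (v : 'rV[R]_d) j :
  (row_mx (t%:M : 'rV[R]_1) v : 'rV[R]_d.+1) 0 (lift ord0 j) = v 0 j.
Proof.
rewrite mxE; case: splitP => l /= E; first by have := ltn_ord l; rewrite -E.
by congr (v _ _); apply: val_inj; case: E.
Qed.

Lemma continuous_row_mx_l d (v : 'rV[R]_d) :
  continuous (fun t : R => row_mx (t%:M : 'rV[R]_1) v : 'rV[R]_d.+1).
Proof.
move=> t; apply: continuous_rV => j; have [k ->|->] := unliftP ord0 j.
  by apply: (eq_continuous_at (fun y => esym (row_mx_lift _ _ _))); exact: cvg_cst.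
by apply: (eq_continuous_at (fun y => esym (row_mx_ord0 _ _))); exact: cvg_id.
Qed.

Lemma continuous_row_mx_r d (t : R) :
  continuous (fun v : 'rV[R]_d => row_mx (t%:M : 'rV[R]_1) v : 'rV[R]_d.+1).
Proof.
move=> v; apply: continuous_rV => j; have [k ->|->] := unliftP ord0 j.
  by apply: (eq_continuous_at (fun y => esym (row_mx_lift _ _ _)));
    exact: coord_continuous.
by apply: (@eq_continuous_at _ _ (fun=> t)) => [y|];
  [by rewrite row_mx_ord0|exact: cst_continuous].
Qed.

Lemma continuous_norm_coord d (x : 'rV[R]_d) (j : 'I_d) :
  {for x, continuous (fun y : 'rV[R]_d => `|y 0 j|)}.
Proof.
apply: (@continuous_comp _ _ _ (fun y : 'rV[R]_d => y 0 j) Num.norm).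
  exact: coord_continuous.
exact: norm_continuous.
Qed.

Lemma near_coord_gt d (x : 'rV[R]_d) (j : 'I_d) (r : R) : r < `|x 0 j| ->
  \forall y \near x, r < `|(y : 'rV[R]_d) 0 j|.
Proof. by move=> rx; have := lt_nbhsr rx; exact: (@continuous_norm_coord d x j). Qed.

Lemma continuous_compact_bound d (A : set 'rV[R]_d) (f : 'rV[R]_d -> R) :
  compact A -> (forall x, A x -> {for x, continuous f}) ->
  exists C, forall x, A x -> `|f x| <= C.
Proof.
move=> cA cf.
have wf : {within A, continuous f}.
  by apply: continuous_in_subspaceT => x /set_mem; exact: cf.
have [M [_ H]] := compact_bounded (continuous_compact wf cA).
by exists (M + 1) => x Ax; apply: (H (M + 1)); [rewrite ltrDl|exists x].
Qed.

Lemma compact_box d (r : R) : compact [set x : 'rV[R]_d | forall i, `|x 0 i| <= r].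
Proof.
have := @rV_compact R d (fun=> `[(- r), r]%classic) (fun=> @segment_compact _ _ _).
rewrite (_ : [set v | _] = [set x : 'rV[R]_d | forall i, `|x 0 i| <= r])//.
by apply/seteqP; split => x /= H i; have := H i; rewrite in_itv/= ler_norml.
Qed.

Lemma open_box d (r : R) : open [set x : 'rV[R]_d | forall i, `|x 0 i| < r].
Proof.
rewrite openE => x /= H.
apply: (@filter_forall _ _ _ (nbhs x)) => i.
have := lt_nbhsl (H i); exact: (@continuous_norm_coord d x i).
Qed.

(** The fundamental theorem of calculus on an interval that contains the support
    in its interior. *)
Lemma integral_derive_cpt (f g : R -> R) (r : R) :
  (forall t : R, is_derive t 1 f (g t)) -> continuous g ->
  (forall t, r < `|t| -> f t = 0) ->
  (\int[lebesgue_measure]_t (g t)%:E = 0)%E.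
Proof.
move=> dfg cg f0.
pose b := `|r| + 1.
have b0 : 0 < b by rewrite ltr_wpDl.
have rb : r < b by rewrite (le_lt_trans (ler_norm r))// ltrDl.
have g0 t : r < `|t| -> g t = 0.
  move=> rt; have [_ <-] := dfg t.
  rewrite (near_eq_derive (g := cst 0)) ?derive_cst//.
  near=> u; apply: f0; near: u.
  have cn : {for t, continuous (Num.norm : R -> R)} by exact: norm_continuous.
  by have := lt_nbhsr rt; exact: cn.
transitivity (\int[lebesgue_measure]_(t in `[(- b)%R, b]) (g t)%:E)%E.
  rewrite [RHS]integral_mkcond; apply: eq_integral => t _.
  rewrite patchE; case: ifPn => // /negP tb; rewrite g0//.
  rewrite ltNge; apply/negP => tr; apply: tb; rewrite inE/= in_itv/= -ler_norml.
  exact: le_trans tr (ltW rb).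
rewrite (@continuous_FTC2 _ g f).
- by rewrite !f0 ?subee// ?normrN gtr0_norm.
- by rewrite gtrN.
- exact: continuous_subspaceT.
- have cf : continuous f.
    move=> t; apply: differentiable_continuous; apply/derivable1_diffP.
    by have [] := dfg t.
  split; first by move=> t _; have [] := dfg t.
    by apply: cvg_at_right_filter; exact: cf.
  by apply: cvg_at_left_filter; exact: cf.
- by move=> t _; rewrite derive1E; have [] := dfg t.
Unshelve. all: by end_near. Qed.

(** By induction on the dimension, since the measure is the product of the
    Lebesgue measure of the first coordinate with the measure of the others. For
    the first coordinate one integrates it first, and the inner integral is zero
    by [integral_derive_cpt]; for another coordinate one integrates the first
    coordinate last, and the inner integral is zero by induction. Regularity is
    asked for in the direction [i] only, because this is all that restricting to
    slices preserves without effort. *)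
Lemma integral_partial_cpt d (g : 'rV[R]_d -> R) (i : 'I_d) (r : R) :
  (forall x, derivable g x (delta_mx 0 i : 'rV[R]_d)) ->
  continuous (partial i g) ->
  (forall (x : 'rV[R]_d) j, r < `|x 0 j| -> g x = 0) ->
  (\int[sfm_measure (eucl R d)]_z (partial i g (eucl_row z))%:E = 0)%E.
Proof.
elim: d g i => [g []//|d IH] g i dg cg g0.
have p0 (x : 'rV[R]_d.+1) j : r < `|x 0 j| -> partial i g x = 0.
  move=> rx; rewrite /partial (near_eq_derive (g := cst 0)) ?derive_cst//.
  by apply: filterS (near_coord_gt rx) => y /g0.
have int_p : (sfm_measure (eucl R d.+1)).-integrable setT
    (EFin \o (fun z => partial i g (eucl_row z))).
  have [C bC] := continuous_compact_bound (@compact_box d.+1 (r + 1))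
    (fun x _ => cg x).
  have bO : forall x : 'rV[R]_d.+1, (forall i, `|x 0 i| < r + 1) ->
      forall i, `|x 0 i| <= r + 1.
    by move=> x H k; exact: ltW.
  have := eucl_integrable (@open_box d.+1 (r + 1)) bO (fun x _ => cg x)
    (fun x Hx => bC x (bO x Hx)).
  set O := _ @^-1` _ => iO.
  have -> : EFin \o (fun z => partial i g (eucl_row z)) =
      (EFin \o (fun z => partial i g (eucl_row z))) \_ O.
    apply/funext => z; rewrite patchE; case: ifPn => // /negP zO.
    have [k rk] : exists k, r < `|eucl_row z 0 k|.
      apply: contrapT => H; apply: zO; rewrite inE => k.
      rewrite ltNge; apply/negP => rk; apply: H; exists k.
      by apply: lt_le_trans rk; rewrite ltrDl.
    by rewrite /= (p0 _ k).
  apply/integrable_restrict; rewrite ?setTI//.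
  by apply: measurable_eucl_open; exact: open_box.
have [j ij|i0] := unliftP ord0 i.
  transitivity (\int[lebesgue_measure]_x \int[sfm_measure (eucl R d)]_y
      (partial i g (eucl_row (d := d.+1) (x, y)))%:E)%E.
    exact: esym (integral12_prod_meas1 int_p).
  rewrite integral0_eq// => x _.
  pose gx (v : 'rV[R]_d) := g (row_mx (x%:M : 'rV[R]_1) v).
  have E v : (derivable gx v (delta_mx 0 j : 'rV[R]_d) <->
      derivable g (row_mx (x%:M : 'rV[R]_1) v) (delta_mx 0 i : 'rV[R]_d.+1)) /\
      partial j gx v = partial i g (row_mx (x%:M : 'rV[R]_1) v).
    by apply: eq_derive_line => h; rewrite /gx row_mx_delta_lift ij.
  have Ep v : partial j gx v = partial i g (row_mx (x%:M : 'rV[R]_1) v).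
    by have [] := E v.
  rewrite -[RHS](IH gx j); first by apply: eq_integral => y _; rewrite Ep.
  - by move=> v; apply/(E v).1; exact: dg.
  - rewrite (_ : partial j gx = partial i g \o (fun v => row_mx (x%:M : 'rV[R]_1) v)).
      by move=> v; apply: continuous_comp; [exact: continuous_row_mx_r|exact: cg].
    by apply/funext => v; rewrite Ep.
  - move=> v k rk; apply: (g0 _ (lift ord0 k)).
    by rewrite row_mx_lift.
transitivity (\int[sfm_measure (eucl R d)]_y \int[lebesgue_measure]_x
    (partial i g (eucl_row (d := d.+1) (x, y)))%:E)%E.
  exact: esym (integral21_prod_meas1 int_p).
rewrite integral0_eq// => y _.
pose f (t : R) := g (row_mx (t%:M : 'rV[R]_1) (eucl_row y)).
have E t : (derivable f t 1 <-> derivable g (row_mx (t%:M : 'rV[R]_1) (eucl_row y))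
      (delta_mx 0 i : 'rV[R]_d.+1)) /\
    'D_1 f t = partial i g (row_mx (t%:M : 'rV[R]_1) (eucl_row y)).
  apply: eq_derive_line => h.
  by rewrite /f i0 -row_mx_delta0 /GRing.scale/= mulr1.
apply: (@integral_derive_cpt f _ r).
- by move=> t; split; [apply/(E t).1; exact: dg|exact: (E t).2].
- move=> t; apply: (@continuous_comp _ _ _
    (fun t : R => row_mx (t%:M : 'rV[R]_1) (eucl_row y) : 'rV[R]_d.+1) (partial i g)).
    exact: continuous_row_mx_l.
  exact: cg.
- by move=> t rt; apply: (g0 _ ord0); rewrite row_mx_ord0.
Qed.

End WholeSpace.

(** * Geometry of the domain *)

Section BoundedSmoothDomain.
Context {R : realType} {d : nat}.
Local Notation vec := 'rV[R]_d.
Variables (Omega : set vec) (m : vec -> vec).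
Hypothesis hOmega : bounded_smooth_domain Omega.
Hypothesis hm : outward_unit_normal Omega m.

Let oO : open Omega. Proof. by have [] := hOmega. Qed.

Lemma boundaryP x : boundary Omega x <-> closure Omega x /\ ~ Omega x.
Proof.
have -> : boundary Omega = closure Omega `\` Omega; last by [].
congr (_ `\` _); apply/seteqP; split; first exact: interior_subset.
by move: oO; rewrite openE.
Qed.

Lemma Omega_near x : Omega x -> \forall y \near x, Omega y.
Proof. by move=> Ox; exact: open_nbhs_nbhs. Qed.

Lemma notin_closure_near x : ~ closure Omega x -> \forall y \near x, ~ Omega y.
Proof.
move=> nx.
have oC : open (~` closure Omega) by apply: closed_openC; exact: closed_closure.
apply: filterS (open_nbhs_nbhs (conj oC nx)) => y ny Oy; apply: ny.
exact: subset_closure.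
Qed.

Lemma Omega_box : exists r, forall x, Omega x -> forall i, `|x 0 i| <= r.
Proof.
have [_ _ _ [M [_ HM]] _] := hOmega.
exists (M + 1) => x Ox i; apply: le_trans (vec_norm_coord x i) _.
by apply: HM => //; rewrite ltrDl.
Qed.

Lemma compact_closure : compact (closure Omega).
Proof.
have [r Hr] := Omega_box.
apply: (subclosed_compact _ (@compact_box R d r)); first exact: closed_closure.
have cb : closed [set x : vec | forall i, `|x 0 i| <= r].
  by apply: compact_closed (@compact_box R d r); exact: norm_hausdorff.
by apply: subset_trans cb; apply: closureS => x /Hr.
Qed.

Lemma compact_boundary : compact (boundary Omega).
Proof.
have -> : boundary Omega = closure Omega `&` ~` Omega.
  by apply/seteqP; split => x /boundaryP.
apply: (subclosed_compact _ compact_closure); last by move=> x [].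
by apply: closedI; [exact: closed_closure|exact: open_closedC].
Qed.

Definition vol_integrable (f : vec -> R) : Prop :=
  (sfm_measure (eucl R d)).-integrable (@eucl_row R d @^-1` Omega)
    (EFin \o (fun z => f (eucl_row z))).

Lemma Omega_integrable (f : vec -> R) (C : R) :
  (forall x, Omega x -> {for x, continuous f}) ->
  (forall x, Omega x -> `|f x| <= C) ->
  vol_integrable f.
Proof.
move=> cf bf; have [r Hr] := Omega_box.
exact: eucl_integrable oO Hr cf bf.
Qed.

Lemma closure_integrable (f : vec -> R) :
  (forall x, closure Omega x -> {for x, continuous f}) ->
  vol_integrable f.
Proof.
move=> cf; have [C bC] := continuous_compact_bound compact_closure cf.
apply: (@Omega_integrable f C) => x /subset_closure; first exact: cf.
exact: bC.
Qed.

Let mO : measurable (@eucl_row R d @^-1` Omega).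
Proof. exact: measurable_eucl_open. Qed.

Lemma eq_vol_int (f g : vec -> R) : (forall x, Omega x -> f x = g x) ->
  vol_int Omega f = vol_int Omega g.
Proof. by move=> fg; apply: eq_Rintegral => z; rewrite inE => /fg. Qed.

(** Extended by zero outside [Omega], such a function is C^1 on the whole space
    and has bounded support. Integrability comes with it, as the extension has
    continuous partial derivatives on the compact closure. *)
Lemma integral_partial_vanish (g : vec -> R) i :
  (forall x, Omega x -> C1 g x) ->
  (forall x, boundary Omega x -> \forall y \near x, g y = 0) ->
  vol_integrable (partial i g) /\
  vol_int Omega (partial i g) = 0.
Proof.
move=> c1g g0.
pose h : vec -> R := patch (fun=> 0) Omega g.
have hO x : Omega x -> h x = g x by move=> Ox; rewrite /h patchE mem_set.
have hN x : ~ Omega x -> h x = 0.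
  by move=> Ox; rewrite /h patchE memNset.
have hin x : Omega x -> \forall y \near x, g y = h y.
  by move=> /Omega_near; apply: filterS => y Oy; rewrite hO.
have hout x : ~ Omega x -> \forall y \near x, 0 = h y.
  move=> nO; have [cx|/notin_closure_near] := pselect (closure Omega x).
    have /g0 : boundary Omega x by apply/boundaryP.
    apply: filterS => y gy; have [Oy|Oy] := pselect (Omega y).
      by rewrite hO.
    by rewrite hN.
  by apply: filterS => y Oy; rewrite hN.
have c1h x : C1 h x.
  have [Ox|Ox] := pselect (Omega x).
    exact: near_eq_C1 (hin x Ox) (c1g x Ox).
  exact: near_eq_C1 (hout x Ox) (C1_cst 0 x).
have dh x : derivable h x (delta_mx 0 i : vec).
  by apply: diff_derivable; exact: C1_diff.
have ch : continuous (partial i h) by move=> x; have [_] := c1h x; exact.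
have [r Hr] := Omega_box.
have h0 (x : vec) j : r < `|x 0 j| -> h x = 0.
  by move=> rx; apply: hN => /Hr /(_ j); rewrite leNgt rx.
have pin x : Omega x -> partial i h x = partial i g x.
  by move=> /hin/near_eq_partial H; rewrite -(nbhs_singleton (H i)).
have pout x : ~ Omega x -> partial i h x = 0.
  move=> /hout/near_eq_partial H; rewrite -(nbhs_singleton (H i)).
  exact: partial_cst.
split.
  have := closure_integrable (fun x _ => ch x).
  by apply: eq_integrable => // z; rewrite inE /= => /pin ->.
rewrite /vol_int /Rintegral -[RHS]/(fine 0%E); congr fine.
rewrite -[RHS](integral_partial_cpt dh ch h0) integral_mkcond.
apply: eq_integral => z _; rewrite patchE; case: ifPn.
  by rewrite inE /= => /pin ->.
by move=> /negP zO; rewrite pout// => Oz; apply: zO; rewrite inE.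
Qed.

(** A positive value of [rho] would persist on a neighbourhood, which would then
    miss [Omega]. *)
Lemma local_defining_bdry0 x0 V rho y : local_defining Omega x0 V rho ->
  V y -> boundary Omega y -> rho y = 0.
Proof.
move=> [oV _ sr _ VO] Vy /boundaryP[cy nOy].
have [r0|r0|//] := ltgtP (rho y) 0; first by case: nOy; apply/VO.
have cr : {for y, continuous rho} by exact: regular_cont (regular_smooth_on 0 oV sr Vy).
have nr : \forall z \near y, 0 < rho z by have := lt_nbhsr r0; exact: cr.
have nV : \forall z \near y, V z by exact: open_nbhs_nbhs.
have [z [Oz [rz Vz]]] := cy _ (filterI nr nV).
by move/(VO _ Vz): Oz; rewrite ltNge (ltW rz).
Qed.

Lemma local_defining_zero_bdry x0 V rho y : local_defining Omega x0 V rho ->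
  V y -> closure Omega y -> rho y = 0 -> boundary Omega y.
Proof.
move=> [_ _ _ _ VO] Vy cy r0; apply/boundaryP; split => //.
by move=> /(VO _ Vy); rewrite r0 ltxx.
Qed.

(** The normal [m y] is a multiple of the gradient of some defining function [rho']
    at [y], possibly another one than [rho]. Both functions are negative exactly on
    [Omega] near [y], hence by [derive_sign] no direction decreases [rho] and
    increases [rho']. If [F] were tangent for [rho'] but not for [rho], adding to
    a multiple of [F] the gradient of [rho'] would produce such a direction. *)
Lemma tangent_grad x0 V rho y (F : vec) : local_defining Omega x0 V rho ->
  V y -> boundary Omega y -> dot F (m y) = 0 -> dot (grad rho y) F = 0.
Proof.
move=> ld Vy bdy.
have [V' [rho' [ld' ->]]] := hm bdy.
have V'y : V' y by case: ld'.
have [oV _ sr nr VO] := ld; have [oV' _ sr' nr' VO'] := ld'.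
rewrite dotZr => /eqP; rewrite mulf_eq0 => /orP[|/eqP Fb].
  rewrite invr_eq0 sqrtr_eq0 leNgt => /negP; elim.
  have := dot_gt0 (nr' _ V'y); rewrite big_ord1 /dot.
  by under [in X in _ -> X]eq_bigr do rewrite expr2.
apply/eqP; apply: contraT => nz.
have b0 := dot_gt0 (nr' _ V'y).
pose a := grad rho y; pose b := grad rho' y.
(* This multiple makes the derivative of rho in the direction sc F + b equal to -1. *)
pose sc := - (dot a F)^-1 * (dot a b + 1).
have : dot (grad rho' y) (sc *: F + b) <= 0.
  have dr : differentiable rho y by exact: regular_diff (regular_smooth_on 0 oV sr Vy).
  have dr' : differentiable rho' y by exact: regular_diff (regular_smooth_on 0 oV' sr'
    V'y).
  apply: (derive_sign dr dr').
  - exact: local_defining_bdry0 ld Vy bdy.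
  - exact: local_defining_bdry0 ld' V'y bdy.
  - have nV : \forall z \near y, V z by exact: open_nbhs_nbhs.
    have nV' : \forall z \near y, V' z by exact: open_nbhs_nbhs.
    by move: nV nV'; apply: filterS2 => z Vz V'z /(VO _ Vz) /(VO' _ V'z).
  - rewrite dotDr dotZr -/a -/b (_ : sc * dot a F = - (dot a b + 1)); first by lra.
    by rewrite /sc; field.
by rewrite dotDr dotZr dotC Fb mulr0 add0r leNgt b0.
Qed.

End BoundedSmoothDomain.

(** * Fields tangent to the boundary *)

Section TangentialFields.
Context {R : realType} {d : nat}.
Local Notation vec := 'rV[R]_d.
Variables (Omega : set vec) (m : vec -> vec).
Hypothesis hOmega : bounded_smooth_domain Omega.
Hypothesis hm : outward_unit_normal Omega m.

Let oO : open Omega. Proof. by have [] := hOmega. Qed.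

Local Notation vol_integrable := (vol_integrable Omega).

Let mO : measurable (@eucl_row R d @^-1` Omega).
Proof. exact: measurable_eucl_open. Qed.

Lemma eq_vol_integrable (f g : vec -> R) : (forall x, Omega x -> f x = g x) ->
  vol_integrable f -> vol_integrable g.
Proof.
by move=> fg; apply: eq_integrable => // z; rewrite inE /= => /fg ->.
Qed.

Lemma vol_integrableD (f g : vec -> R) : vol_integrable f -> vol_integrable g ->
  vol_integrable (fun x => f x + g x).
Proof. by move=> vf vg; exact: integrableD vf vg. Qed.

Lemma vol_integrableZ (a : R) (f : vec -> R) : vol_integrable f ->
  vol_integrable (fun x => a * f x).
Proof. by move=> vf; exact: integrableZl vf. Qed.

Lemma vint0 : vol_integrable (fun=> 0).
Proof. exact: integrable0. Qed.

Lemma vol_intD (f g : vec -> R) : vol_integrable f -> vol_integrable g ->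
  vol_int Omega (fun x => f x + g x) = vol_int Omega f + vol_int Omega g.
Proof. by move=> vf vg; rewrite /vol_int RintegralD. Qed.

Lemma vol_intZ (a : R) (f : vec -> R) : vol_integrable f ->
  vol_int Omega (fun x => a * f x) = a * vol_int Omega f.
Proof. by move=> vf; rewrite /vol_int RintegralZl. Qed.

Lemma vol_int0 : vol_int Omega (fun=> 0) = 0.
Proof. by rewrite /vol_int /Rintegral integral0. Qed.

Lemma vol_integrable_sum n (f : 'I_n -> vec -> R) : (forall i, vol_integrable (f i)) ->
  vol_integrable (fun x => \sum_i f i x) /\
  vol_int Omega (fun x => \sum_i f i x) = \sum_i vol_int Omega (f i).
Proof.
elim: n f => [|n IH] f vf.
  split; first by apply: eq_vol_integrable vint0 => x _; rewrite big_ord0.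
  rewrite [RHS]big_ord0 -[RHS]vol_int0.
  by apply: eq_vol_int => x _; rewrite big_ord0.
have [vs Es] := IH _ (fun i => vf (lift ord0 i)).
rewrite big_ord_recl -Es -vol_intD//; split.
  by apply: eq_vol_integrable (vol_integrableD (vf ord0) vs) => x _; rewrite big_ord_recl.
by apply: eq_vol_int => x _; rewrite big_ord_recl.
Qed.

Definition tangential (F : vec -> vec) : Prop :=
  (forall x, closure Omega x -> forall i, C1 (component F i) x) /\
  (forall x, boundary Omega x -> dot (F x) (m x) = 0).

(** The function [grad rho . F] vanishes on the boundary and is Lipschitz, and
    [- rho] is comparable to the distance to the boundary. Both facts are used
    along the segments issued from a point of [Omega] in the direction of the
    fixed vector [N = grad rho x0], for which [rho] grows at a rate at least [c].
    If [- rho x] is small, such a segment reaches the boundary after a time at most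
    [- rho x / c] and stays in [Omega] until then, so that the derivatives of [F],
      which are only
    controlled on the closure of [Omega], are bounded along it. *)
Lemma tangent_estimate x0 V rho : boundary Omega x0 ->
  local_defining Omega x0 V rho ->
  exists2 del, 0 < del & (forall x, ball x0 del x -> V x) /\
    forall F, tangential F -> exists e C, 0 < e /\
      forall x, Omega x -> ball x0 del x -> - e < rho x ->
        `|dot (grad rho x) (F x)| <= C * - rho x.
Proof.
move=> bd ld; have [oV Vx0 sr nr VO] := ld.
pose N := grad rho x0.
have NN : 0 < dot N N by apply: dot_gt0; exact: nr.
pose c := dot N N / 2.
have c0 : 0 < c by rewrite divr_gt0.
pose p x := dot (grad rho x) N.
have [e2 /= e20 He2] : exists2 e2, 0 < e2 & forall x, ball x0 e2 x -> V x /\ c < p x.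
  have cp : {for x0, continuous p} by apply: C1_dot_grad;
    exact: regular_C1 (regular_smooth_on 1 oV sr Vx0).
  have np : \forall x \near x0, c < p x.
    have cp0 : c < p x0 by rewrite /p -/N /c; lra.
    by have := lt_nbhsr cp0; exact: cp.
  have nV : \forall x \near x0, V x by exact: open_nbhs_nbhs.
  have : nbhs x0 [set x | V x /\ c < p x] by exact: filterI nV np.
  by move=> /nbhs_ballP[e2 /= e20 H]; exists e2 => // x /H.
pose e3 := e2 / 2.
have e30 : 0 < e3 by rewrite divr_gt0.
have sub3 x : `|x0 - x| <= e3 -> ball x0 e2 x.
  move=> xe; apply: (subset_closure_half e20).
  by rewrite (closed_ballE _ e30).
exists (e3 / 2); first by rewrite divr_gt0.
split.
  move=> x; rewrite -ball_normE /ball_/= => xb.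
  by have [] := He2 x; rewrite // -?ball_normE /ball_/=; rewrite /e3 in xb *; lra.
move=> F [cF tF].
pose g x := dot (grad rho x) (F x).
pose K := closure Omega `&` closed_ball x0 e3.
have cK : compact K.
  apply: (subclosed_compact _ (compact_closure hOmega)); last by move=> x [].
  by apply: closedI; [exact: closed_closure|exact: closed_ball_closed].
have KV x : K x -> V x.
  by move=> [_ /(subset_closure_half e20) /He2 []].
have c1g x : K x -> C1 g x.
  move=> Kx; apply: (@near_eq_C1 _ _ (fun y => \sum_i partial i rho y * component F i y)).
    by apply: near_all => y; apply: eq_bigr => i _; rewrite mxE.
  apply: C1_sum => i; apply: C1M; last by apply: cF; case: Kx.
  by apply: (@regular_C1 _ _ 0); apply: regular_partial;
    exact: regular_smooth_on sr (KV _ Kx).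
have [L HL] : exists L, forall x, K x -> `|dot (grad g x) N| <= L.
  by apply: continuous_compact_bound cK _ => x Kx; exact: C1_dot_grad (c1g x Kx).
(* Any positive upper bound of the norm of N would do; adding 1 avoids a case
   distinction. *)
pose nu := `|N| + 1.
have nu0 : 0 < nu by rewrite ltr_wpDl.
exists (c * e3 / (2 * nu)), (L / c); split.
  by rewrite divr_gt0 ?mulr_gt0.
move=> x Ox; rewrite -ball_normE /ball_/= => xb xe.
have rx : rho x < 0.
  apply/VO => //; have [] := He2 x => //; apply: sub3; apply: ltW.
  by apply: lt_trans xb _; rewrite ltr_pdivrMr//; lra.
pose T := - rho x / c.
have T0 : 0 < T by rewrite divr_gt0 ?oppr_gt0.
have TN : T * nu < e3 / 2.
  have : - rho x < c * e3 / (2 * nu) by rewrite ltrNl.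
  rewrite ltr_pdivlMr ?mulr_gt0// => H.
  rewrite /T mulrAC ltr_pdivrMr//; lra.
have seg t : 0 <= t <= T -> `|x0 - (x + t *: N)| <= e3.
  move=> /andP[t0 tT].
  have -> : x0 - (x + t *: N) = (x0 - x) - t *: N by rewrite opprD addrA.
  apply: le_trans (ler_normB _ _) _; rewrite normrZ (ger0_norm t0).
  have : t * `|N| <= T * nu.
    by apply: ler_pM => //; rewrite lerDl.
  by move=> ?; lra.
have segH t : 0 <= t <= T -> V (x + t *: N) /\ c < p (x + t *: N).
  by move=> /seg/sub3/He2.
have dif t : 0 <= t <= T -> differentiable rho (x + t *: N).
  by move=> /segH[Vt _]; exact: regular_diff (regular_smooth_on 0 oV sr Vt).
(* On the segment rho grows at least linearly: hence it vanishes at some time t <= T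
   and is negative before. *)
have grow a b : 0 <= a -> a <= b -> b <= T ->
    c * (b - a) <= rho (x + b *: N) - rho (x + a *: N).
  move=> a0 ab bT; apply: line_growth => // t /andP[at_ tb].
  have tT : 0 <= t <= T by rewrite (le_trans a0 at_) (le_trans tb bT).
  by split; [exact: dif|have [_ /ltW] := segH t tT].
have [t tT rt] : exists2 t, 0 <= t <= T & rho (x + t *: N) = 0.
  have cl : {within `[0, T], continuous (fun u => rho (x + u *: N))}.
    apply: derivable_within_continuous => u uT.
    by have [] := is_derive_line (dif u uT).
  have := @IVT R (fun u => rho (x + u *: N)) 0 T 0 (ltW T0) cl.
  rewrite scale0r addr0 => -[|u uT ru]; last by exists u.
  have hT : 0 <= rho (x + T *: N).
    have := grow 0 T (lexx _) (ltW T0) (lexx _).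
    rewrite scale0r addr0 subr0 /T mulrC divfK ?gt_eqF//; lra.
  by rewrite ge_min (ltW rx)/= le_max hT orbT.
have t0 : 0 <= t by case/andP: tT.
have inO u : 0 <= u -> u < t -> Omega (x + u *: N).
  move=> u0 ut; have uT : 0 <= u <= T.
    by rewrite u0/=; apply: ltW; apply: lt_le_trans ut _; case/andP: tT.
  apply/VO; first by have [] := segH u uT.
  have := grow u t u0 (ltW ut); rewrite rt => /(_ _)H.
  have tT' : t <= T by case/andP: tT.
  have : 0 < c * (t - u) by rewrite mulr_gt0// subr_gt0.
  by have := H tT'; lra.
have t_gt0 : 0 < t.
  rewrite lt_neqAle t0 andbT; apply/negP => /eqP E.
  by move: rt; rewrite -E scale0r addr0 => r0; move: rx; rewrite r0 ltxx.
have cl : closure Omega (x + t *: N).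
  move=> B nB.
  have lim : (x + u *: N) @[u --> t^'-] --> x + t *: N.
    apply: cvgD; first exact: cvg_cst.
    by apply: cvgZr_tmp; apply: cvg_at_left_filter; exact: cvg_id.
  have n1 : \forall u \near t^'-, B (x + u *: N) by exact: lim nB.
  have n2 : \forall u \near t^'-, u < t by exact: nbhs_left_lt.
  have n3 : \forall u \near t^'-, 0 < u by exact: nbhs_left_gt.
  have [u [Bu [ut u0]]] := filter_ex (filterI n1 (filterI n2 n3)).
  by exists (x + u *: N); split => //; apply: inO => //; exact: ltW.
have inK u : 0 <= u <= t -> K (x + u *: N).
  move=> /andP[u0 ut]; split.
    move: ut; rewrite le_eqVlt => /orP[/eqP ->//|ut].
    by apply: subset_closure; exact: inO.
  rewrite (closed_ballE _ e30); apply: seg; rewrite u0/=.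
  by apply: le_trans ut _; case/andP: tT.
have by_ : boundary Omega (x + t *: N).
  apply: (local_defining_zero_bdry hOmega ld) => //.
  by have [] := segH t tT.
have gy : g (x + t *: N) = 0.
  apply: (tangent_grad hOmega hm ld) => //; first by have [] := segH t tT.
  exact: tF.
have : `|g (x + t *: N) - g x| <= L * t.
  apply: line_lipschitz => // u ut; split; first exact: C1_diff (c1g _ (inK u ut)).
  exact: HL (inK u ut).
rewrite gy sub0r normrN => /le_trans; apply.
have L0 : 0 <= L.
  by apply: le_trans (HL _ (inK 0 _)); rewrite ?normr_ge0// lexx.
rewrite -mulrA [_^-1 * _]mulrC; apply: ler_wpM2l => //.
by case/andP: tT.
Qed.

End TangentialFields.

(** * The divergence theorem without boundary flux *)

Section DivergenceTheorem.
Context {R : realType} {d : nat}.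
Local Notation vec := 'rV[R]_d.
Variables (Omega : set vec) (m : vec -> vec).
Hypothesis hOmega : bounded_smooth_domain Omega.
Hypothesis hm : outward_unit_normal Omega m.
Local Notation vol_integrable := (vol_integrable Omega).
Local Notation tangential := (tangential Omega m).

Let oO : open Omega. Proof. by have [] := hOmega. Qed.

Let mO : measurable (@eucl_row R d @^-1` Omega).
Proof. exact: measurable_eucl_open. Qed.

Lemma tangential_divergence_continuous F x : tangential F -> closure Omega x ->
  {for x, continuous (divergence F)}.
Proof.
move=> [cF _] cx; apply: continuous_at_sum => i.
by have [_] := cF x cx i; exact.
Qed.

Lemma near_eq_divergence0 (F : vec -> vec) x : (\forall y \near x, F y = 0) ->
  divergence F x = 0.
Proof.
move=> F0; rewrite /divergence big1// => i _.
have H : \forall y \near x, 0 = component F i y.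
  by apply: filterS F0 => y Fy; rewrite /component Fy mxE.
by rewrite -(nbhs_singleton (near_eq_partial i H)) partial_cst.
Qed.

(** The local statements that the bump functions patch together. *)
Definition local_divergence x0 (del : R) : Prop :=
  forall F, tangential F -> (forall x, ~ ball x0 del x -> \forall y \near x, F y = 0) ->
    vol_int Omega (divergence F) = 0.

(** Dominated convergence, with a constant as dominating function since [Omega] has
    finite measure. *)
Lemma vol_int_dominated (f : nat -> vec -> R) (g : vec -> R) (M : R) :
  (forall n, vol_integrable (f n)) -> (forall n, vol_int Omega (f n) = 0) ->
  (forall n x, Omega x -> `|f n x| <= M) ->
  (forall x, Omega x -> \forall n \near \oo, f n x = g x) ->
  vol_int Omega g = 0.
Proof.
move=> vf f0 fM fg.
have intM : (sfm_measure (eucl R d)).-integrable (@eucl_row R d @^-1` Omega)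
    (fun=> M%:E).
  apply: (@Omega_integrable _ _ _ hOmega (fun=> M) `|M|) => // x _.
  exact: cst_continuous.
have z0 n : (\int[sfm_measure (eucl R d)]_(z in @eucl_row R d @^-1` Omega)
    (f n (eucl_row z))%:E = 0)%E.
  have := f0 n; rewrite /vol_int /Rintegral => H.
  by rewrite -[LHS]fineK ?H//; exact: integrable_fin_num (vf n).
have := @dominated_cvg _ _ _ (sfm_measure (eucl R d)) _ mO
  (fun n z => (f n (eucl_row z))%:E) (fun z => (g (eucl_row z))%:E) (fun=> M%:E).
have -> : (fun n => \int[sfm_measure (eucl R d)]_(z in @eucl_row R d @^-1` Omega)
    (f n (eucl_row z))%:E)%E = cst 0%E by apply/funext => n; exact: z0.
move=> H; rewrite /vol_int /Rintegral -[RHS]/(fine 0%E); congr fine.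
rewrite -(cvg_lim _ (H _ _ _ _ _)) ?lim_cst//.
- by move=> n; exact: measurable_int (vf n).
- move=> z Oz; apply: cvg_near_cst.
  by apply: filterS (fg _ Oz) => n ->.
- by move=> n z Oz; rewrite lee_fin; exact: fM.
Qed.

(** The cutoffs are [step (tau n)] with [tau n = - kap n rho - 1]: they vanish
    where [- rho <= 1 / kap n] and equal 1 where [- rho >= 2 / kap n]. In between
    [- rho < 2 / kap n], so [tangent_estimate] bounds the term that contains the
    derivative of the cutoff by [8 * `|C|], uniformly in [n]; at a given point
    this term is zero for large [n]. *)
Lemma local_divergence_boundary x0 : boundary Omega x0 ->
  exists2 del, 0 < del & local_divergence x0 del.
Proof.
move=> bd0.
have [V [rho ld]] : exists V rho, local_defining Omega x0 V rho.
  by have [_ _ _ _ sb] := hOmega; exact: sb.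
have [oV Vx0 sr _ VO] := ld.
have [del del0 [delV est]] := tangent_estimate hOmega hm bd0 ld.
exists del => // F tF F0; have [cF bF] := tF.
have [e [C [e0 He]]] := est F tF.
(* With this scaling 2 / kap n <= e, so that the estimate applies on the whole
   transition layer for every n. *)
pose kap (n : nat) : R := 2 * n.+1%:R / e.
have kap0 n : 0 < kap n by rewrite divr_gt0// mulr_gt0.
pose tau n x := (- kap n) * rho x + (-1).
pose G n i x := step (tau n x) * component F i x.
have c1tau n x : V x -> C1 (tau n) x.
  move=> Vx; apply: C1D; last exact: C1_cst.
  by apply: C1M; [exact: C1_cst|exact: regular_C1 (regular_smooth_on 1 oV sr Vx)].
have Gout n i x : ~ ball x0 del x -> \forall y \near x, 0 = G n i y.
  by move=> /F0; apply: filterS => y Fy; rewrite /G /component Fy mxE mulr0.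
have C1G n i x : Omega x -> C1 (G n i) x.
  move=> Ox; have [/delV Vx|/Gout H] := pselect (ball x0 del x).
    apply: C1M; first by apply: C1_step; exact: c1tau.
    by apply: cF; exact: subset_closure.
  by apply: near_eq_C1 (H n i) _; exact: C1_cst.
have van n i x : boundary Omega x -> \forall y \near x, G n i y = 0.
  move=> bx; have [/delV Vx|/Gout H] := pselect (ball x0 del x); last first.
    by apply: filterS (H n i) => y.
  have r0 := local_defining_bdry0 hOmega ld Vx bx.
  have t0 : tau n x < 0 by rewrite /tau r0 mulr0 add0r ltrN10.
  by move: (continuous_near_lt (C1_cont (c1tau n x Vx)) t0);
    apply: filterS => y /ltW ty; rewrite /G step_le0// mul0r.
pose f n x := \sum_i partial i (G n i) x.
have vG n i := integral_partial_vanish hOmega i (C1G n i) (van n i).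
have [D HD] : exists D, forall x, closure Omega x -> `|divergence F x| <= D.
  apply: continuous_compact_bound (compact_closure hOmega) _ => x cx.
  exact: tangential_divergence_continuous.
have fin n x : Omega x -> ball x0 del x -> f n x =
    step (tau n x) * divergence F x -
      kap n * dstep (tau n x) * dot (grad rho x) (F x).
  move=> Ox bx; have Vx := delV _ bx.
  have dr : differentiable rho x by exact: regular_diff (regular_smooth_on 0 oV sr Vx).
  have dk : differentiable (fun _ : vec => - kap n) x by exact: differentiable_cst.
  have dkr : differentiable (fun y => - kap n * rho y) x by exact: differentiableM.
  have dtau : differentiable (tau n) x by exact: C1_diff (c1tau n x Vx).
  have dst : differentiable (fun y => step (tau n y)) x.
    by apply: C1_diff; apply: C1_step; exact: c1tau.
  rewrite /f /divergence /dot !mulr_sumr -sumrB; apply: eq_bigr => i _.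
  have dF : differentiable (component F i) x.
    by apply: C1_diff; apply: cF; exact: subset_closure.
  have dtaui : partial i (tau n) x = - kap n * partial i rho x.
    have d1 : differentiable (fun _ : vec => -1 : R) x by exact: differentiable_cst.
    have -> : partial i (tau n) x = _ := partialD i dkr d1.
    by rewrite partialM// !partial_cst mulr0 !addr0.
  by rewrite partialM// partial_step// dtaui mxE /component; ring.
have fout n x : Omega x -> ~ ball x0 del x -> f n x = 0 /\ divergence F x = 0.
  move=> Ox bx; split; last by apply: near_eq_divergence0; exact: F0.
  rewrite /f big1// => i _.
  by rewrite -(nbhs_singleton (near_eq_partial i (Gout n i x bx))) partial_cst.
have vf n : vol_integrable (f n) /\ vol_int Omega (f n) = 0.
  have [vs Es] := vol_integrable_sum hOmega (fun i => (vG n i).1).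
  split; first exact: vs.
  by rewrite [LHS]Es big1// => i _; exact: (vG n i).2.
apply: (@vol_int_dominated f _ (D + 8 * `|C|)).
- by move=> n; exact: (vf n).1.
- by move=> n; exact: (vf n).2.
- move=> n x Ox; have Dx := HD x (subset_closure Ox).
  have [bx|bx] := pselect (ball x0 del x); last first.
    have [-> _] := fout n x Ox bx; rewrite normr0 addr_ge0 ?mulr_ge0//.
    by apply: le_trans Dx.
  rewrite fin//; apply: le_trans (ler_normB _ _) _; apply: lerD.
    by rewrite normrM; apply: le_trans Dx; rewrite ler_piMl ?step_bound.
  have rx : rho x < 0 by apply/VO => //; exact: delV.
  have [t0|t0] := leP (tau n x) 0.
    by rewrite dstep_le0// mulr0 mul0r normr0 mulr_ge0.
  have [t1|t1] := leP 1 (tau n x).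
    by rewrite dstep_ge1// mulr0 mul0r normr0 mulr_ge0.
  have kr : kap n * - rho x < 2 by move: t1; rewrite /tau; lra.
  have xe : - e < rho x.
    rewrite ltrNl -(ltr_pM2l (kap0 n)); apply: lt_le_trans kr _.
    rewrite /kap divfK ?gt_eqF//; have : (1 : R) <= n.+1%:R by rewrite ler1n.
    by lra.
  have Hg := He x Ox bx xe.
  rewrite normrM [`|kap n * _|]normrM (gtr0_norm (kap0 n)).
  have Hkg : kap n * `|dot (grad rho x) (F x)| <= 2 * `|C|.
    have a1 : kap n * `|dot (grad rho x) (F x)| <= kap n * (C * - rho x).
      by rewrite ler_pM2l.
    apply: le_trans a1 _.
    have a2 : C * (kap n * - rho x) <= `|C| * (kap n * - rho x).
      by rewrite ler_wpM2r ?ler_norm// mulr_ge0 ?ltW// oppr_gt0.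
    have a3 : `|C| * (kap n * - rho x) <= `|C| * 2 by rewrite ler_wpM2l// ltW.
    by rewrite mulrCA; lra.
  have ds := dstep_bound (tau n x).
  rewrite mulrAC.
  have : kap n * `|dot (grad rho x) (F x)| * `|dstep (tau n x)| <= 2 * `|C| * 4.
    by apply: ler_pM => //; rewrite mulr_ge0// ltW.
  by lra.
- move=> x Ox; have [bx|bx] := pselect (ball x0 del x); last first.
    by near=> n; have [-> ->] := fout n x Ox bx.
  have rx : rho x < 0 by apply/VO => //; exact: delV.
  near=> n; rewrite fin//.
  have t1 : 1 <= tau n x.
    have : e / - rho x <= n%:R by near: n; exact: nbhs_infty_ger.
    rewrite ler_pdivrMr ?oppr_gt0// => en.
    rewrite /tau /kap -[X in _ <= X]/(- (2 * n.+1%:R / e) * rho x - 1).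
    have : 1 <= n.+1%:R * - rho x / e.
      by rewrite ler_pdivlMr// mul1r -natr1; lra.
    by lra.
  by rewrite step_ge1// dstep_ge1// mulr0 mul0r subr0 mul1r.
Unshelve. all: by end_near. Qed.

Lemma tangential_scale (f : vec -> R) F :
  (forall x, closure Omega x -> C1 f x) ->
  (forall x, closure Omega x -> forall i, C1 (component F i) x) ->
  (forall x, boundary Omega x -> dot (F x) (m x) = 0) ->
  tangential (fun x => f x *: F x).
Proof.
move=> cf cF bF; split=> [x cx i|x bx].
  apply: near_eq_C1 (C1M (cf x cx) (cF x cx i)).
  by apply: near_all => y; rewrite /component mxE.
by rewrite dotC dotZr dotC bF// mulr0.
Qed.

Lemma tangential_vol_integrable_divergence F : tangential F ->
  vol_integrable (divergence F).
Proof.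
move=> tF; apply: closure_integrable => // x cx.
exact: tangential_divergence_continuous.
Qed.

(** The squared Euclidean distance: unlike the maximum norm it is a
    polynomial, so that bump functions built from it are C^1. *)
Definition dist2 (a x : vec) : R := \sum_i (x 0 i - a 0 i) ^+ 2.

Lemma C1_dist2 a x : C1 (dist2 a) x.
Proof.
apply: C1_sum => i.
have cc : C1 (fun y : vec => y 0 i - a 0 i) x.
  apply: C1D; last exact: C1_cst.
  split; first by apply: near_all => y; exact: differentiable_coord.
  move=> j; apply: (@eq_continuous_at _ _ (fun=> (delta_mx 0 j : vec) 0 i)).
    by move=> y; rewrite partial_coord.
  exact: cst_continuous.
by apply: near_eq_C1 (C1M cc cc); apply: near_all => y; rewrite expr2.
Qed.

Lemma dist2_ball a x r : 0 < r -> ~ ball a r x -> r ^+ 2 <= dist2 a x.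
Proof.
move=> r0 nb; rewrite leNgt; apply/negP => dr; apply: nb; split => // i j.
rewrite ord1 -ball_normE /ball_/= -[X in _ < X](ger0_norm (ltW r0)).
rewrite -ltr_sqr ?nnegrE// !real_normK ?num_real//.
apply: le_lt_trans dr; rewrite /dist2 (bigD1 j)//= -[X in X <= _]addr0 -opprB sqrrN.
by apply: lerD => //; apply: sumr_ge0 => k _; exact: sqr_ge0.
Qed.

(** Equal to 1 where the squared distance to [p.1] is at most [p.2], and to 0 where
    it is at least twice as large, for positive [p.2]. *)
Definition bump (p : vec * R) (x : vec) : R := step (2 - dist2 p.1 x / p.2).

Lemma C1_bump p x : C1 (bump p) x.
Proof.
apply: C1_step.
apply: (@near_eq_C1 _ _ (fun y => - p.2^-1 * dist2 p.1 y + 2)).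
  by apply: near_all => y; rewrite mulNr addrC mulrC.
apply: C1D; last exact: C1_cst.
by apply: C1M; [exact: C1_cst|exact: C1_dist2].
Qed.

(** The support of [bump p] lies in a ball around [p.1] where the local divergence
    theorem holds. *)
Definition localized (p : vec * R) : Prop :=
  0 < p.2 /\ exists del, [/\ 0 < del, 2 * p.2 < del ^+ 2 & local_divergence p.1 del].

Lemma localized_divergence p F : localized p -> tangential F ->
  vol_int Omega (divergence (fun x => bump p x *: F x)) = 0.
Proof.
move=> [p0 [del [del0 pd ldiv]]] [cF bF]; apply: ldiv.
  by apply: tangential_scale => // x _; exact: C1_bump.
move=> x nb; have dx := dist2_ball del0 nb.
have : 2 * p.2 < dist2 p.1 x by exact: lt_le_trans dx.
move=> /(continuous_near_gt (C1_cont (C1_dist2 p.1 x))); apply: filterS => y dy.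
rewrite /bump step_le0 ?scale0r// subr_le0 ler_pdivlMr//; exact: ltW.
Qed.

(** The field [F] is the sum of [bump p *: F] and [(1 - bump p) *: F]. The first
    one is covered by the local theorem, and the second one vanishes near the
    boundary points that are close to [p.1], so that one bump less is needed. *)
Lemma divergence_finite_cover (l : seq (vec * R)) F :
  (forall p, p \in l -> localized p) -> tangential F ->
  (forall x, boundary Omega x -> (forall p, p \in l -> p.2 <= dist2 p.1 x) ->
    \forall y \near x, F y = 0) ->
  vol_int Omega (divergence F) = 0.
Proof.
elim: l F => [|p l IH] F gl tF van; have [cF bF] := tF.
  have vG i : vol_integrable (partial i (component F i)) /\
      vol_int Omega (partial i (component F i)) = 0.
    apply: (integral_partial_vanish hOmega i) => x bx.
      by apply: cF; exact: subset_closure.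
    by apply: filterS (van x bx _) => // y Fy; rewrite /component Fy mxE.
  have [_ Es] := vol_integrable_sum hOmega (fun i => (vG i).1).
  by rewrite [LHS]Es big1// => i _; exact: (vG i).2.
have gp : localized p by apply: gl; rewrite mem_head.
pose G x := (1 + (-1) * bump p x) *: F x.
have tb : tangential (fun x => bump p x *: F x).
  by apply: tangential_scale => // x _; exact: C1_bump.
have tG : tangential G.
  apply: tangential_scale => // x _; apply: C1D; first exact: C1_cst.
  by apply: C1M; [exact: C1_cst|exact: C1_bump].
have -> : vol_int Omega (divergence F) =
    vol_int Omega (fun x => divergence (fun y => bump p y *: F y) x + divergence G x).
  apply: eq_vol_int => x Ox; have cx := subset_closure Ox.
  rewrite /divergence -big_split; apply: eq_bigr => i _ /=.
  rewrite -partialD.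
  - congr (partial i _ x); apply/funext => y; rewrite /component !mxE; ring.
  - by apply: C1_diff; apply: tb.1.
  - by apply: C1_diff; apply: tG.1.
rewrite vol_intD; [|exact: hOmega|exact: tangential_vol_integrable_divergence..].
rewrite localized_divergence// add0r; apply: IH => //.
  by move=> q ql; apply: gl; rewrite in_cons ql orbT.
move=> x bx Hx; have [px|px] := ltP (dist2 p.1 x) p.2.
  move: px => /(continuous_near_lt (C1_cont (C1_dist2 p.1 x))); apply: filterS => y dy.
  have p0 : 0 < p.2 by case: gp.
  rewrite /G /bump step_ge1 ?mulr1 ?subrr ?scale0r//.
  have : dist2 p.1 y / p.2 <= 1 by rewrite ler_pdivrMr// mul1r ltW.
  by lra.
have : \forall y \near x, F y = 0.
  by apply: van => // q; rewrite in_cons => /orP[/eqP ->|/Hx].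
by apply: filterS => y Fy; rewrite /G Fy scaler0.
Qed.

(** By compactness finitely many of the sets where a bump function equals 1 cover
    the boundary. *)
Theorem divergence_tangent F : tangential F -> vol_int Omega (divergence F) = 0.
Proof.
move=> tF.
have := compact_boundary hOmega; rewrite compact_cover => cc.
have [||l lg lc] := cc _ (localized : set (vec * R)) (fun p =>
  [set x | dist2 p.1 x < p.2]).
- move=> p _; rewrite openE => x /= px.
  exact: continuous_near_lt (C1_cont (C1_dist2 p.1 x)) px.
- move=> x bx; have [del del0 ldiv] := local_divergence_boundary bx.
  (* The bump vanishes where the squared distance exceeds del^2 / 2, in particular
     outside the ball of radius del. *)
exists (x, del ^+ 2 / 4).
    split; first by rewrite /= divr_gt0// exprn_gt0.
    exists del; split => //=; have : 0 < del ^+ 2 by exact: exprn_gt0.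
    by lra.
  rewrite /= /dist2 big1; first by rewrite divr_gt0// exprn_gt0.
  by move=> i _; rewrite subrr expr0n.
apply: (@divergence_finite_cover (finmap.enum_fset l)) => //.
  by move=> p /lg /set_mem.
move=> x bx H; have [p /= pl] := lc x bx.
by rewrite ltNge H.
Qed.

(** The integrand is the divergence of [f *: F]. The sum is kept together, since
    this is the form in which it enters the energy identity. *)
Lemma integration_by_parts (f : vec -> R) F :
  (forall x, closure Omega x -> C1 f x) ->
  (forall x, closure Omega x -> forall i, C1 (component F i) x) ->
  (forall x, boundary Omega x -> dot (F x) (m x) = 0) ->
  vol_integrable (fun x => f x * divergence F x + dot (grad f x) (F x)) /\
  vol_int Omega (fun x => f x * divergence F x + dot (grad f x) (F x)) = 0.
Proof.
move=> cf cF bF; have tfF := tangential_scale cf cF bF.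
have E x : Omega x -> divergence (fun x => f x *: F x) x =
    f x * divergence F x + dot (grad f x) (F x).
  move=> /subset_closure cx.
  rewrite /divergence mulr_sumr /dot -big_split; apply: eq_bigr => i _ /=.
  rewrite (_ : component (fun x => f x *: F x) i = fun y => f y * component F i y).
    rewrite partialM; [|exact: C1_diff (cf x cx)|exact: C1_diff (cF x cx i)].
    by rewrite mxE [F x 0 i * _]mulrC.
  by apply/funext => y; rewrite /component mxE.
split; first exact: eq_vol_integrable E (tangential_vol_integrable_divergence tfF).
by rewrite -(divergence_tangent tfF); apply: eq_vol_int => x Ox; rewrite E.
Qed.

End DivergenceTheorem.

(** * Fields regular up to the boundary *)

Section SmoothFields.
Context {R : realType} {d : nat}.
Local Notation vec := 'rV[R]_d.
Variable Omega : set vec.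

Definition regular_on k (f : vec -> R) := forall x, closure Omega x -> regular k f x.

Definition mx_regular_on k p q (F : vec -> 'M[R]_(p, q)) :=
  forall i j, regular_on k (fun x => F x i j).

Lemma eq_regular_on k (f g : vec -> R) : f =1 g -> regular_on k f -> regular_on k g.
Proof. by move=> /funext ->. Qed.

Lemma regular_onW k f : regular_on k.+1 f -> regular_on k f.
Proof. by move=> sf x /sf; exact: regularW. Qed.

Lemma regular_on_cst k a : regular_on k (fun=> a).
Proof. by move=> x _; exact: regular_cst. Qed.

Lemma regular_onD k f g : regular_on k f -> regular_on k g ->
  regular_on k (fun x => f x + g x).
Proof. by move=> sf sg x cx; apply: regularD; [exact: sf|exact: sg]. Qed.

Lemma regular_onB k f g : regular_on k f -> regular_on k g ->
  regular_on k (fun x => f x - g x).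
Proof. by move=> sf sg x cx; apply: regularB; [exact: sf|exact: sg]. Qed.

Lemma regular_onM k f g : regular_on k f -> regular_on k g ->
  regular_on k (fun x => f x * g x).
Proof. by move=> sf sg x cx; apply: regularM; [exact: sf|exact: sg]. Qed.

Lemma regular_onZ k a f : regular_on k f -> regular_on k (fun x => a * f x).
Proof. by apply: regular_onM; exact: regular_on_cst. Qed.

Lemma regular_on_sum k n (f : 'I_n -> vec -> R) : (forall i, regular_on k (f i)) ->
  regular_on k (fun x => \sum_i f i x).
Proof. by move=> sf x cx; apply: regular_sum => i; exact: sf. Qed.

Lemma regular_on_partial k f i : regular_on k.+1 f -> regular_on k (partial i f).
Proof. by move=> sf x cx; apply: regular_partial; exact: sf. Qed.

Lemma regular_on_smooth k f : smooth_closure Omega f -> regular_on k f.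
Proof. by move=> sf x; exact: smooth_closure_regular. Qed.

Lemma mx_regular_on_smooth k u : smooth_closure_vec Omega u -> mx_regular_on k u.
Proof. by move=> su i j; rewrite ord1; exact: regular_on_smooth (su j). Qed.

Lemma mx_regular_onD k p q (F G : vec -> 'M[R]_(p, q)) : mx_regular_on k F ->
  mx_regular_on k G ->
  mx_regular_on k (fun x => F x + G x).
Proof.
move=> sF sG i j; apply: eq_regular_on (regular_onD (sF i j) (sG i j)) => x.
by rewrite mxE.
Qed.

Lemma mx_regular_onZ k p q f (F : vec -> 'M[R]_(p, q)) : regular_on k f ->
  mx_regular_on k F ->
  mx_regular_on k (fun x => f x *: F x).
Proof. by move=> sf sF i j; apply: eq_regular_on (regular_onM sf (sF i j)) => x;
  rewrite mxE. Qed.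

Lemma mx_regular_on_tr k p q (F : vec -> 'M[R]_(p, q)) : mx_regular_on k F ->
  mx_regular_on k (fun x => (F x)^T).
Proof. by move=> sF i j; apply: eq_regular_on (sF j i) => x; rewrite mxE. Qed.

Lemma mx_regular_on_mul k p q r (F : vec -> 'M[R]_(p, q)) (G : vec -> 'M[R]_(q, r)) :
  mx_regular_on k F -> mx_regular_on k G -> mx_regular_on k (fun x => F x *m G x).
Proof.
move=> sF sG i j.
apply: eq_regular_on (regular_on_sum (fun l => regular_onM (sF i l) (sG l j))) => x;
  by rewrite mxE.
Qed.

Lemma regular_on_dot k (a b : vec -> vec) : mx_regular_on k a -> mx_regular_on k b ->
  regular_on k (fun x => dot (a x) (b x)).
Proof. by move=> sa sb; apply: regular_on_sum => i; exact: regular_onM. Qed.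

Lemma mx_regular_on_grad k f : regular_on k.+1 f -> mx_regular_on k (grad f).
Proof.
by move=> sf i j; apply: eq_regular_on (regular_on_partial j sf) => x; rewrite mxE.
Qed.

Lemma regular_on_divergence k u : mx_regular_on k.+1 u -> regular_on k (divergence u).
Proof. by move=> su; apply: regular_on_sum => i; apply: regular_on_partial;
  exact: su. Qed.

Lemma mx_regular_on_gradv k u : mx_regular_on k.+1 u -> mx_regular_on k (gradv u).
Proof.
by move=> su i j; apply: eq_regular_on (regular_on_partial j (su 0 i)) => x; rewrite mxE.
Qed.

Lemma mx_regular_on_symgrad k u : mx_regular_on k.+1 u -> mx_regular_on k (symgrad u).
Proof.
move=> su; apply: (mx_regular_onZ (regular_on_cst _ _)); apply: mx_regular_onD;
  first exact: mx_regular_on_gradv.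
by apply: mx_regular_on_tr; exact: mx_regular_on_gradv.
Qed.

Lemma mx_regular_on_divergence_mx k (S : vec -> 'M[R]_d) : mx_regular_on k.+1 S ->
  mx_regular_on k (divergence_mx S).
Proof.
move=> sS i j; apply: eq_regular_on (regular_on_sum (fun l =>
  regular_on_partial l (sS j l))) => x.
by rewrite mxE.
Qed.

Lemma mx_regular_on_mxapp k (A : vec -> 'M[R]_d) (a : vec ->
  vec) : mx_regular_on k A -> mx_regular_on k a ->
  mx_regular_on k (fun x => mxapp (A x) (a x)).
Proof. by move=> sA sa; apply: mx_regular_on_mul => //; exact: mx_regular_on_tr. Qed.

Lemma mx_regular_on_outer k (a b : vec -> vec) : mx_regular_on k a -> mx_regular_on k b ->
  mx_regular_on k (fun x => outer (a x) (b x)).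
Proof. by move=> sa sb; apply: mx_regular_on_mul => //; exact: mx_regular_on_tr. Qed.

Lemma mx_regular_on_sigma k (c : cn_params R) u f : mx_regular_on k.+1 u ->
  regular_on k.+1 f ->
  mx_regular_on k (sigma c u f).
Proof.
move=> su sf; have sg := mx_regular_on_grad sf; have sD := mx_regular_on_symgrad su.
have sDg := mx_regular_on_mxapp sD sg; apply: mx_regular_onD; [apply: mx_regular_onD|].
- apply: mx_regular_onZ; last exact: mx_regular_on_outer.
  by apply: regular_onZ; exact: regular_on_dot.
- by apply: mx_regular_onZ => //; exact: regular_on_cst.
- apply: (mx_regular_onZ (regular_on_cst _ _)).
  by apply: mx_regular_onD; exact: mx_regular_on_outer.
Qed.

Lemma regular_on_C1 k f x : regular_on k.+1 f -> closure Omega x -> C1 f x.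
Proof. by move=> sf /sf; exact: regular_C1. Qed.

Lemma regular_on_diff k f x : regular_on k f -> closure Omega x -> differentiable f x.
Proof. by move=> sf /sf; exact: regular_diff. Qed.

(** Used to extend to the boundary the equations that are only known inside. *)
Lemma regular_on_closure0 f : regular_on 0 f -> (forall x, Omega x -> f x = 0) ->
  forall x, closure Omega x -> f x = 0.
Proof.
move=> sf f0 x cx; apply/eqP; apply: contraT => fx.
have cf : {for x, continuous (fun y => `|f y|)}.
  apply: (@continuous_comp _ _ _ f Num.norm); last exact: norm_continuous.
  exact: regular_cont (sf x cx).
have fx0 : 0 < `|f x| by rewrite normr_gt0.
have [y [Oy]] := cx _ (continuous_near_gt cf fx0).
by rewrite /= f0// normr0 ltxx.
Qed.

End SmoothFields.

Section Integrals.
Context {R : realType} {d : nat}.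
Local Notation vec := 'rV[R]_d.
Variables (Omega : set vec).
Hypothesis hOmega : bounded_smooth_domain Omega.

(** Integrability and value are proved together, so that linear combinations of
    integrals can be formed without side conditions. *)
Definition has_vol_int (f : vec -> R) (v : R) : Prop :=
  vol_integrable Omega f /\ vol_int Omega f = v.

Lemma has_vol_intD f g v w : has_vol_int f v -> has_vol_int g w ->
  has_vol_int (fun x => f x + g x) (v + w).
Proof.
move=> [vf <-] [vg <-]; split; [exact: vol_integrableD|exact: vol_intD].
Qed.

Lemma has_vol_intZ a f v : has_vol_int f v -> has_vol_int (fun x => a * f x) (a * v).
Proof. move=> [vf <-]; split; [exact: vol_integrableZ|exact: vol_intZ]. Qed.

Lemma has_vol_int_eq f g v w : has_vol_int f v -> has_vol_int g w ->
  (forall x, Omega x -> f x = g x) -> v = w.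
Proof. by move=> [_ <-] [_ <-] fg; exact: eq_vol_int. Qed.

Lemma regular_on_has_vol_int k f : regular_on Omega k f ->
  has_vol_int f (vol_int Omega f).
Proof.
move=> sf; split => //; apply: closure_integrable => // x cx.
exact: regular_cont (sf x cx).
Qed.

Lemma has_vol_int_L2norm k f : regular_on Omega k f ->
  has_vol_int (fun x => f x ^+ 2) (L2norm Omega f ^+ 2).
Proof.
move=> sf; have [vf _] := regular_on_has_vol_int (regular_onM sf sf); split.
  by apply: eq_vol_integrable vf => // x _; rewrite expr2.
rewrite /L2norm sqr_sqrtr//.
by apply: Rintegral_ge0 => z _; exact: sqr_ge0.
Qed.

Lemma has_vol_int_L2norm_mx k p q (F : vec -> 'M[R]_(p, q)) : mx_regular_on Omega k F ->
  has_vol_int (fun x => \sum_i \sum_j F x i j ^+ 2) (L2norm_mx Omega F ^+ 2).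
Proof.
move=> sF.
have E x : frob (F x) ^+ 2 = \sum_i \sum_j F x i j ^+ 2.
  rewrite /frob sqr_sqrtr//; apply: sumr_ge0 => i _; apply: sumr_ge0 => j _.
  exact: sqr_ge0.
have sS : regular_on Omega k (fun x => \sum_i \sum_j F x i j * F x i j).
  by apply: regular_on_sum => i; apply: regular_on_sum => j; exact: regular_onM.
have [vS _] := regular_on_has_vol_int sS; split; first exact: vS.
rewrite /L2norm_mx /L2norm sqr_sqrtr.
  by apply: eq_vol_int => x _; rewrite E.
by apply: Rintegral_ge0 => z _; exact: sqr_ge0.
Qed.

End Integrals.

Section Contraction.
Context {R : realType} {d : nat}.
Local Notation vec := 'rV[R]_d.
Implicit Types (A B : 'M[R]_d) (a b : vec).

(** The Frobenius inner product of matrices. *)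
Definition contract A B : R := \sum_i \sum_j A i j * B i j.

Lemma contractDl A A' B : contract (A + A') B = contract A B + contract A' B.
Proof.
rewrite /contract -big_split; apply: eq_bigr => i _; rewrite -big_split.
by apply: eq_bigr => j _; rewrite mxE mulrDl.
Qed.

Lemma contractZl t A B : contract (t *: A) B = t * contract A B.
Proof.
rewrite /contract mulr_sumr; apply: eq_bigr => i _; rewrite mulr_sumr.
by apply: eq_bigr => j _; rewrite mxE mulrA.
Qed.

Lemma contractC A B : contract A B = contract B A.
Proof. by apply: eq_bigr => i _; apply: eq_bigr => j _; rewrite mulrC. Qed.

Lemma contract_tr A B : contract A^T B^T = contract A B.
Proof.
rewrite /contract exchange_big; apply: eq_bigr => i _; apply: eq_bigr => j _.
by rewrite !mxE.
Qed.

Lemma mxappE A a i : mxapp A a 0 i = \sum_j a 0 j * A i j.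
Proof. by rewrite mxE; apply: eq_bigr => j _; rewrite mxE. Qed.

Lemma contract_outer a b A : contract (outer a b) A = dot a (mxapp A b).
Proof.
apply: eq_bigr => i _; rewrite mxappE mulr_sumr; apply: eq_bigr => j _.
by rewrite mxE big_ord1 mxE mulrA.
Qed.

Lemma outer_tr a b : (outer a b)^T = outer b a.
Proof. by rewrite /outer trmx_mul trmxK. Qed.

Lemma contract_sym A G : A^T = A -> contract A G = contract A (2^-1 *: (G + G^T)).
Proof.
move=> AT; rewrite contractC [RHS]contractC contractZl contractDl.
have -> : contract G^T A = contract G A by rewrite -[in LHS]AT contract_tr.
by field.
Qed.

(** The stress is symmetric, so only the symmetric part [D] of the velocity
    gradient [G] contributes. *)
Lemma stress_contract (t1 t4 t5 : R) g D G : D = 2^-1 *: (G + G^T) ->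
  contract ((t1 * dot g (mxapp D g)) *: outer g g + t4 *: D +
         t5 *: (outer (mxapp D g) g + outer g (mxapp D g))) G =
    t1 * dot g (mxapp D g) ^+ 2 + t4 * contract D D +
    2 * t5 * dot (mxapp D g) (mxapp D g).
Proof.
move=> DG.
have trD (A B : 'M[R]_d) : (A + B)^T = A^T + B^T by rewrite linearD.
have trZ t (A : 'M[R]_d) : (t *: A)^T = t *: A^T by rewrite linearZ.
have DT : D^T = D by rewrite DG trZ trD trmxK addrC.
rewrite contract_sym; last first.
  by rewrite !(trD, trZ) !outer_tr DT [outer g _ + outer _ g]addrC.
rewrite -DG !(contractDl, contractZl) !contract_outer.
have -> : dot g (mxapp D (mxapp D g)) = dot (mxapp D g) (mxapp D g).
  by rewrite -!contract_outer -[in LHS]contract_tr outer_tr DT.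
by ring.
Qed.

Lemma sigma_contract (c : cn_params R) (u : vec -> vec) (f : vec -> R) x :
  let g := grad f x in let D := symgrad u x in
  contract (sigma c u f x) (gradv u x) =
    mu1 c * dot g (mxapp D g) ^+ 2 + mu4 c * contract D D +
    2 * mu5 c * dot (mxapp D g) (mxapp D g).
Proof. by move=> g D; exact: stress_contract. Qed.

End Contraction.

(** * The energy law *)

Section StepAlgebra.
Context {R : realType} {d : nat}.
Local Notation vec := 'rV[R]_d.
Implicit Types a b c : vec.

Lemma sum_sqr_row (v : vec) : \sum_i \sum_j v i j ^+ 2 = dot v v.
Proof. by rewrite big_ord1; apply: eq_bigr => j _; rewrite expr2. Qed.

Lemma sum_sqr_contract (A : 'M[R]_d) : \sum_i \sum_j A i j ^+ 2 = contract A A.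
Proof. by apply: eq_bigr => i _; apply: eq_bigr => j _; rewrite expr2. Qed.

(** The momentum equation [t^-1 (w - v0) + b - st + g0 - a gf = 0] tested with
    [t h], where the intermediate velocity [w] and the midpoint velocity [h] are
    expressed by the new velocity [v1] and the pressure gradients [g1] and [g0]
    of the two time levels. The squares of [g1 - g0] recombine to a difference of
    squares because [g0] is tested with [h] and not with the old velocity. *)
Lemma velocity_balance (t a : R) (v1 v0 w h g1 g0 b st gf : vec) : t != 0 ->
  t^-1 *: (w - v0) + b - st + g0 - a *: gf = 0 ->
  w = v1 + (t / 2) *: (g1 - g0) ->
  h = 2^-1 *: (v1 + v0) + (t / 4) *: (g1 - g0) ->
  2^-1 * dot v1 v1 - 2^-1 * dot v0 v0 + t ^+ 2 / 8 * (dot g1 g1 - dot g0 g0) =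
  - t * dot b h + t * dot st h + t * a * dot gf h
  - t / 2 * dot g1 v1 - t / 2 * dot g0 v0.
Proof.
move=> t0 /(congr1 (fun v => t * dot v h)).
rewrite !(dotDl, dotNl, dotZl) dot0l mulr0 => H wE hE.
have {H} : t * dot b h - t * dot st h - t * a * dot gf h =
    - (dot w h - dot v0 h) - t * dot g0 h.
  apply/eqP; rewrite -subr_eq0; apply/eqP; rewrite -[RHS]H; field.
  exact: t0.
have -> : - (dot w h - dot v0 h) - t * dot g0 h =
   2^-1 * dot v0 v0 - 2^-1 * dot v1 v1 - t ^+ 2 / 8 * (dot g1 g1 - dot g0 g0)
   - t / 2 * dot g1 v1 - t / 2 * dot g0 v0.
  rewrite hE wE !(dotDl, dotDr, dotNl, dotNr, dotZl, dotZr).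
  rewrite [dot v0 v1]dotC [dot v1 g1]dotC [dot v1 g0]dotC [dot v0 g1]dotC.
  by rewrite [dot v0 g0]dotC [dot g0 g1]dotC; field.
by clear wE hE; move=> H; lra.
Qed.

Lemma projection_update (t : R) (v1 w g : vec) : t != 0 ->
  t^-1 *: (v1 - w) + 2^-1 *: g = 0 -> w = v1 + (t / 2) *: g.
Proof.
move=> t0 H; apply/rowP => i; have := congr1 (fun v : vec => t * v 0 i) H.
by rewrite !mxE mulr0 mulrDr mulrA mulfV// mul1r; clear H; move=> H; lra.
Qed.

Lemma midpoint_velocity (t : R) (v1 v0 w g : vec) : w = v1 + (t / 2) *: g ->
  2^-1 *: (w + v0) = 2^-1 *: (v1 + v0) + (t / 4) *: g.
Proof. by move=> ->; apply/rowP => i; rewrite !mxE; field. Qed.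

(** The pointwise energy identity as polynomial algebra. The letters stand for:
    [P] the material derivative phi-dot, [L] the Laplacian of the midpoint psi,
    [D3] and [D4] the divergences of U grad phi-star and of phi-star v,
    [f] the value of phi-star, [df] the increment phi^{n+1} - phi^n, [a] and [b]
    the products of the gradient of this increment with those of the midpoint psi
    and of phi-star, [gu] the product of grad phi-dot with
    the midpoint velocity, [Bh] and [sh] the products of the convection and of
    div sigma with it, [C] the viscous dissipation. The hypotheses are the
    momentum equation, the form of the convection, the definition of phi-dot, the
    phase-field equation and the update of U. *)
Lemma scalar_balance (t K ke iM P L D3 D4 df U1 U0 s1 s0 a b f gu Bh sh C : R)
    (v11 v00 g11 g00 g1v1 g0v0 j5 : R) :
  2^-1 * v11 - 2^-1 * v00 + t ^+ 2 / 8 * (g11 - g00) =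
    - t * Bh + t * sh + t * (iM * f) * gu - t / 2 * g1v1 - t / 2 * g0v0 ->
  Bh = 2^-1 * j5 -> t * D4 = t * P - df -> iM * P = K * L + ke * D3 ->
  U1 - U0 = 2 * b ->
  (2^-1 * v11 + K / 2 * s1 ^+ 2 + ke / 4 * U1 ^+ 2 + t ^+ 2 / 8 * g11)
  + (-1) * (2^-1 * v00 + K / 2 * s0 ^+ 2 + ke / 4 * U0 ^+ 2 + t ^+ 2 / 8 * g00)
  + (t * iM * P ^+ 2 + t * C) =
  K * (df * L + a) + (- K) * ((s1 + s0) / 2 * (s0 - s1) + a)
  + ke * (df * D3 + (U1 + U0) / 2 * b)
  + t * (iM * P * D4 + f * (iM * gu)) + (- (t / 2)) * j5 + t * (sh + C)
  + (- (t / 2)) * g1v1 + (- (t / 2)) * g0v0.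
Proof.
move=> V Bj hD4 hP hb.
have -> : j5 = 2 * Bh by rewrite Bj; field.
have -> : b = (U1 - U0) / 2 by rewrite hb; field.
have hdf : df = t * P - t * D4 by rewrite hD4; ring.
have e1 : df * (iM * P) = df * (K * L + ke * D3) by rewrite hP.
have e2 : (t * P - t * D4) * (iM * P) = df * (iM * P) by rewrite hdf.
by clear Bj hD4 hP hb hdf; lra.
Qed.

Lemma solve_balance (e1 e0 x y : R) :
  e1 + (-1) * e0 + (x + y) = 0 -> e1 = e0 - x - y.
Proof. by move=> H; lra. Qed.

End StepAlgebra.

Section EnergyLaw.
Context {R : realType} {d : nat}.
Local Notation vec := 'rV[R]_d.
Variables (Omega : set vec) (m : vec -> vec).
Hypothesis hOmega : bounded_smooth_domain Omega.
Hypothesis hm : outward_unit_normal Omega m.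
Local Notation regular_on := (regular_on Omega).
Local Notation mx_regular_on := (mx_regular_on Omega).
Local Notation has_vol_int := (has_vol_int Omega).

Let bdcl x : boundary Omega x -> closure Omega x. Proof. by case. Qed.

Lemma has_vol_int_ibp (f : vec -> R) F : regular_on 1 f -> mx_regular_on 1 F ->
  (forall x, boundary Omega x -> dot (F x) (m x) = 0) ->
  has_vol_int (fun x => f x * divergence F x + dot (grad f x) (F x)) 0.
Proof.
move=> sf sF bF; apply: (integration_by_parts hOmega hm) => // x cx.
  exact: regular_on_C1 sf cx.
by move=> i; exact: regular_on_C1 (sF 0 i) cx.
Qed.

(** If [v] vanishes on the boundary, then so does the field [S^T v], whose divergence
    is the integrand. *)
Lemma has_vol_int_viscous (S : vec -> 'M[R]_d) (v : vec -> vec) : mx_regular_on 1 S ->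
  mx_regular_on 1 v ->
  (forall x, boundary Omega x -> v x = 0) \/ ibp_justified Omega S v ->
  has_vol_int (fun x => dot (divergence_mx S x) (v x) + contract (S x) (gradv v x)) 0.
Proof.
move=> sS sv bd.
have s1 : regular_on 0 (fun x => dot (divergence_mx S x) (v x)).
  by apply: regular_on_dot; [exact: mx_regular_on_divergence_mx|exact: (fun i j =>
    regular_onW (sv i j))].
have s2 : regular_on 0 (fun x => contract (S x) (gradv v x)).
  apply: regular_on_sum => i; apply: regular_on_sum => j; apply: regular_onM;
    last exact: mx_regular_on_gradv.
  exact: regular_onW (sS i j).
have [v1 _] := regular_on_has_vol_int hOmega s1;
  have [v2 _] := regular_on_has_vol_int hOmega s2.
split; first exact: vol_integrableD.
case: bd => [v0|ibp]; last first.
  by rewrite vol_intD// [X in X + _]ibp addNr.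
pose F x : vec := \row_j \sum_i S x i j * v x 0 i.
have sF : mx_regular_on 1 F.
  move=> i j; apply: eq_regular_on (regular_on_sum (fun l =>
    regular_onM (sS l j) (sv 0 l))) => x.
  by rewrite mxE.
have bF x : boundary Omega x -> dot (F x) (m x) = 0.
  move=> bx; rewrite /dot big1// => i _; rewrite mxE big1 ?mul0r// => j _.
  by rewrite v0// mxE mulr0.
have [_ <-] := has_vol_int_ibp (@regular_on_cst R d Omega 1 1) sF bF.
apply: eq_vol_int => x Ox; have cx := subset_closure Ox.
rewrite mul1r [dot (grad _ _) _](_ : _ = 0) ?addr0; last first.
  by rewrite /dot big1// => i _; rewrite mxE partial_cst mul0r.
have dS i j : differentiable (fun y => S y i j) x by exact: regular_on_diff (sS i j) cx.
have dv i : differentiable (component v i) x by exact: regular_on_diff (sv 0 i) cx.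
have E j : partial j (component F j) x = \sum_i (S x i j *
    partial j (component v i) x + component v i x * partial j (fun y => S y i j) x).
  rewrite (_ : component F j = fun y => \sum_i S y i j * component v i y).
    rewrite partial_sum; last by move=> i; exact: differentiableM (dS i j) (dv i).
    by apply: eq_bigr => i _; rewrite partialM.
  by apply/funext => y; rewrite /component mxE.
rewrite /divergence; under [in RHS]eq_bigr do rewrite E.
rewrite exchange_big /dot /contract -big_split/=; apply: eq_bigr => i _.
rewrite mxE mulr_suml -big_split/=; apply: eq_bigr => j _.
by rewrite mxE /component; ring.
Qed.

Lemma laplacianB (f g : vec -> R) x : regular_on 1 f -> regular_on 1 g -> Omega x ->
  laplacian (fun y => f y - g y) x = laplacian f x - laplacian g x.
Proof.
move=> sf sg Ox; have cx := subset_closure Ox.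
rewrite /laplacian /divergence -sumrB; apply: eq_bigr => i _.
have cE (h : vec -> R) : component (grad h) i = partial i h.
  by apply/funext => y; rewrite /component mxE.
rewrite !cE -partialB; [|exact: regular_on_diff (regular_on_partial i sf) cx|
  exact: regular_on_diff (regular_on_partial i sg) cx].
rewrite /partial; apply: near_eq_derive.
apply: filterS (Omega_near hOmega Ox) => y /subset_closure cy.
by rewrite -/(partial i _ y) partialB//;
  [exact: regular_on_diff sf cy|exact: regular_on_diff sg cy].
Qed.

(** The term with half the divergence of [u] makes the convection the divergence of
    half of [|v|^2 u]. *)
Lemma dot_advection (u v : vec -> vec) x : mx_regular_on 1 v -> closure Omega x ->
  dot (Bform u v x) (v x) =
  2^-1 * (dot (v x) (v x) * divergence u x + dot (grad (fun y =>
    dot (v y) (v y)) x) (u x)).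
Proof.
move=> sv cx.
have dv i : differentiable (component v i) x by exact: regular_on_diff (sv 0 i) cx.
have E j : partial j (fun y => dot (v y) (v y)) x =
    2 * \sum_i component v i x * partial j (component v i) x.
  rewrite partial_sum; last by move=> i; exact: differentiableM (dv i) (dv i).
  rewrite mulr_sumr; apply: eq_bigr => i _; rewrite (partialM j (dv i) (dv i)).
  by rewrite mulrDl mul1r.
rewrite /Bform dotDl dotZl.
have -> : dot (grad (fun y => dot (v y) (v y)) x) (u x) =
    2 * dot (mxapp (gradv v x) (u x)) (v x).
  transitivity (2 * \sum_i \sum_j
      component v i x * partial j (component v i) x * u x 0 j).
    rewrite exchange_big /dot mulr_sumr; apply: eq_bigr => j _.
    by rewrite mxE E -mulrA mulr_suml.
  congr (_ * _); apply: eq_bigr => i _; rewrite mxappE mulr_suml.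
  by apply: eq_bigr => j _; rewrite mxE /component; ring.
by field.
Qed.

Variables (c : cn_params R) (hc : cn_params_ok c).
Variables (s : cn_iterates R d) (hs : cn_scheme c s Omega m).

Lemma regular_on_phi k n : regular_on k (phi s n).
Proof. by have [/(_ n) [[? _ _ _] _] _ _ _] := hs; exact: regular_on_smooth. Qed.

Lemma regular_on_psi k n : regular_on k (psi s n).
Proof. by have [/(_ n) [[_ ? _ _] _] _ _ _] := hs; exact: regular_on_smooth. Qed.

Lemma regular_on_U k n : regular_on k (auxU s n).
Proof. by have [/(_ n) [[_ _ ? _] _] _ _ _] := hs; exact: regular_on_smooth. Qed.

Lemma regular_on_pres k n : regular_on k (pres s n).
Proof. by have [/(_ n) [[_ _ _ ?] _] _ _ _] := hs; exact: regular_on_smooth. Qed.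

Lemma mx_regular_on_vel k n : mx_regular_on k (vel s n).
Proof. by have [/(_ n) [_ [? _]] _ _ _] := hs; exact: mx_regular_on_smooth. Qed.

Lemma mx_regular_on_ut k n : mx_regular_on k (ut s n.+1).
Proof. by have [/(_ n) [_ [_ ?]] _ _ _] := hs; exact: mx_regular_on_smooth. Qed.

Lemma regular_on_phi_star k n : regular_on k (phi_star s n).
Proof. by apply: regular_onB; apply: regular_onZ; exact: regular_on_phi. Qed.

Lemma mx_regular_on_vel_star k n : mx_regular_on k (vel_star s n).
Proof.
have H := mx_regular_onD (mx_regular_onZ (@regular_on_cst R d Omega k (3 / 2))
  (mx_regular_on_vel k n))
  (mx_regular_onZ (@regular_on_cst R d Omega k (- 2^-1)) (mx_regular_on_vel k n.-1)).
by move=> i j; apply: eq_regular_on (H i j) => x; rewrite /vel_star scaleNr.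
Qed.

Lemma regular_on_psi_half k n : regular_on k (psi_half s n).
Proof.
by apply: regular_onM; [apply: regular_onD; exact: regular_on_psi|exact: regular_on_cst].
Qed.

Lemma regular_on_U_half k n : regular_on k (U_half s n).
Proof. by apply: regular_onM; [apply: regular_onD;
  exact: regular_on_U|exact: regular_on_cst]. Qed.

Lemma mx_regular_on_ut_half k n : mx_regular_on k (ut_half s n).
Proof.
by apply: mx_regular_onZ; [exact: regular_on_cst|apply: mx_regular_onD;
  [exact: mx_regular_on_ut|exact: mx_regular_on_vel]].
Qed.

Lemma regular_on_phi_dot k n : regular_on k (phi_dot c s n).
Proof.
apply: regular_onD.
  by apply: regular_onM; [apply: regular_onB;
    exact: regular_on_phi|exact: regular_on_cst].
by apply: regular_on_divergence; apply: mx_regular_onZ;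
  [exact: regular_on_phi_star|exact: mx_regular_on_ut_half].
Qed.

Lemma psi_laplacian n x : Omega x -> psi s n x = - laplacian (phi s n) x.
Proof.
have [_ [_ H0 _ _ _] H1 _] := hs.
by case: n => [|n] Ox; [exact: H0|have [[_ H _ _] _] := H1 n x Ox].
Qed.

Lemma divergence_vel n x : Omega x -> divergence (vel s n) x = 0.
Proof.
have [_ [_ _ _ H0 _] H1 _] := hs.
by case: n => [|n] Ox; [exact: H0|have [_ [_ H]] := H1 n x Ox].
Qed.

Lemma vel_normal n x : boundary Omega x -> dot (vel s n x) (m x) = 0.
Proof.
have [_ [_ _ _ _ H0] _ H1] := hs.
case: n => [|n] bx; first by rewrite H0// dot0l.
by have [_ H] := H1 n x bx.
Qed.

Lemma phi_neumann n x : boundary Omega x -> dot (grad (phi s n) x) (m x) = 0.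
Proof.
have [_ [H0 _ _ _ _] _ H1] := hs.
move=> bx; rewrite -derive_grad;
  last exact: regular_on_diff (regular_on_phi 0 n) (bdcl bx).
case: n => [|n]; first by have [] := H0 x bx.
by have [[_ H _] _] := H1 n x bx.
Qed.

(** For [n = 0] the initial data only prescribe the normal derivative of the
    Laplacian of phi. As psi^0 is minus this Laplacian in the interior, the two
    gradients agree up to the boundary by continuity. *)
Lemma psi_neumann n x : boundary Omega x -> dot (grad (psi s n) x) (m x) = 0.
Proof.
have [_ [H0 _ _ _ _] _ H1] := hs.
move=> bx; have cx := bdcl bx.
have sl k : regular_on k (laplacian (phi s 0)).
  by apply: regular_on_divergence; apply: mx_regular_on_grad; exact: regular_on_phi.
case: n => [|n]; last first.
  rewrite -derive_grad; last exact: regular_on_diff (regular_on_psi 0 n.+1) cx.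
  by have [[_ _ H] _] := H1 n x bx.
have -> : grad (psi s 0) x = - grad (laplacian (phi s 0)) x.
  apply/eqP; rewrite -addr_eq0 -gradD;
    [|exact: regular_on_diff (regular_on_psi 0 0) cx|exact: regular_on_diff (sl 0%N) cx].
  apply/eqP/rowP => i; rewrite !mxE.
  have sp : regular_on 0 (partial i (fun y => psi s 0 y + laplacian (phi s 0) y)).
    by apply: regular_on_partial; apply: regular_onD; [exact: regular_on_psi|exact: sl].
  apply: (regular_on_closure0 sp) cx => y Oy.
  have H : \forall z \near y, 0 = psi s 0 z + laplacian (phi s 0) z.
    by apply: filterS (Omega_near hOmega Oy) => z /psi_laplacian ->; rewrite addNr.
  by rewrite -(nbhs_singleton (near_eq_partial i H)) partial_cst.
rewrite dotNl -derive_grad; last exact: regular_on_diff (sl 0%N) cx.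
by have [_ ->] := H0 x bx; rewrite oppr0.
Qed.

Lemma grad_phi_star n x : closure Omega x ->
  grad (phi_star s n) x = (3 / 2) *: grad (phi s n) x - 2^-1 *: grad (phi s n.-1) x.
Proof.
move=> cx.
have d0 k : differentiable (phi s k) x by exact: regular_on_diff (regular_on_phi 0 k) cx.
by rewrite -!gradZ// -gradB//; exact: regular_on_diff (regular_onZ _ (regular_on_phi 0
  _)) cx.
Qed.

Lemma grad_psi_half n x : closure Omega x ->
  grad (psi_half s n) x = 2^-1 *: (grad (psi s n.+1) x + grad (psi s n) x).
Proof.
move=> cx.
have d0 k : differentiable (psi s k) x by exact: regular_on_diff (regular_on_psi 0 k) cx.
rewrite -gradD// -gradZ; last exact: regular_on_diff (regular_onD (regular_on_psi 0 _)
  (regular_on_psi 0 _)) cx.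
by congr (grad _ x); apply/funext => y; rewrite mulrC.
Qed.

Lemma ut_half_normal n x : boundary Omega x -> dot (ut_half s n x) (m x) = 0.
Proof.
have [_ _ _ H1] := hs; move=> bx; have [[H _ _] _] := H1 n x bx.
by rewrite /ut_half H add0r dotZl vel_normal// mulr0.
Qed.

Lemma vel_star_normal n x : boundary Omega x -> dot (vel_star s n x) (m x) = 0.
Proof. by move=> bx; rewrite /vel_star dotDl dotNl !dotZl !vel_normal// !mulr0 subr0. Qed.

Lemma phi_star_neumann n x : boundary Omega x -> dot (grad (phi_star s n) x) (m x) = 0.
Proof.
move=> bx; rewrite grad_phi_star; last exact: bdcl.
by rewrite dotDl dotNl !dotZl !phi_neumann// !mulr0 subr0.
Qed.

Lemma ut_half0_boundary x : boundary Omega x -> ut_half s 0 x = 0.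
Proof.
have [_ [_ _ _ _ H0] _ H1] := hs; move=> bx; have [[H _ _] _] := H1 0%N x bx.
by rewrite /ut_half H H0// addr0 scaler0.
Qed.

Section Step.
Variable n : nat.
Hypothesis hibp : (0 < n)%N -> viscous_ibp_justified c s Omega n.

Local Notation K := (elastK c).
Local Notation M := (mobM c).
Local Notation tau := (dt c).
Local Notation uh := (ut_half s n).
Local Notation phs := (phi_star s n).
Local Notation psh := (psi_half s n).
Local Notation Uh := (U_half s n).
Local Notation phd := (phi_dot c s n).

Let W (x : vec) : R := M^-1 * phd x.
Let dphi (x : vec) : R := phi s n.+1 x - phi s n x.
Let q (x : vec) : R := dot (uh x) (uh x).
Let S (x : vec) : 'M[R]_d := sigma c uh phs x.
Let J1 (x : vec) := dphi x * divergence (grad psh) x + dot (grad dphi x) (grad psh x).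
Let J2 (x : vec) := psh x * divergence (grad dphi) x + dot (grad psh x) (grad dphi x).
Let J3 (x : vec) := dphi x * divergence (fun y => Uh y *: grad phs y) x +
  dot (grad dphi x) (Uh x *: grad phs x).
Let J4 (x : vec) := W x * divergence (fun y => phs y *: uh y) x +
  dot (grad W x) (phs x *: uh x).
Let J5 (x : vec) := q x * divergence (vel_star s n) x + dot (grad q x) (vel_star s n x).
Let J6 k (x : vec) := pres s k x * divergence (vel s k) x +
  dot (grad (pres s k) x) (vel s k x).
Let JV (x : vec) := dot (divergence_mx S x) (uh x) + contract (S x) (gradv uh x).

Let regular_on_dphi k : regular_on k dphi. Proof. by apply: regular_onB;
  exact: regular_on_phi. Qed.
Let regular_on_W k : regular_on k W. Proof. by apply: regular_onZ;
  exact: regular_on_phi_dot. Qed.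
Let regular_on_q k : regular_on k q. Proof. by apply: regular_on_dot;
  exact: mx_regular_on_ut_half. Qed.
Let mx_regular_on_S k : mx_regular_on k S.
Proof. by apply: mx_regular_on_sigma;
  [exact: mx_regular_on_ut_half|exact: regular_on_phi_star]. Qed.

Let grad_dphi x : closure Omega x ->
  grad dphi x = grad (phi s n.+1) x - grad (phi s n) x.
Proof. by move=> cx; rewrite -gradB//;
  exact: regular_on_diff (regular_on_phi 0 _) cx. Qed.

Let dphi_neumann x : boundary Omega x -> dot (grad dphi x) (m x) = 0.
Proof.
move=> bx; rewrite grad_dphi; last exact: bdcl.
by rewrite dotDl dotNl !phi_neumann// subr0.
Qed.

Let hJ1 : has_vol_int J1 0.
Proof.
apply: has_vol_int_ibp => //; first by apply: mx_regular_on_grad;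
  exact: regular_on_psi_half.
move=> x bx; rewrite grad_psi_half; last exact: bdcl.
by rewrite dotZl dotDl !psi_neumann// addr0 mulr0.
Qed.

Let hJ2 : has_vol_int J2 0.
Proof. by apply: has_vol_int_ibp => //;
  [exact: regular_on_psi_half|exact: mx_regular_on_grad]. Qed.

Let hJ3 : has_vol_int J3 0.
Proof.
apply: has_vol_int_ibp => //.
  by apply: mx_regular_onZ; [exact: regular_on_U_half|apply: mx_regular_on_grad;
    exact: regular_on_phi_star].
by move=> x bx; rewrite dotZl phi_star_neumann// mulr0.
Qed.

Let hJ4 : has_vol_int J4 0.
Proof.
apply: has_vol_int_ibp => //.
  by apply: mx_regular_onZ; [exact: regular_on_phi_star|exact: mx_regular_on_ut_half].
by move=> x bx; rewrite dotZl ut_half_normal// mulr0.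
Qed.

Let hJ5 : has_vol_int J5 0.
Proof.
by apply: has_vol_int_ibp => //; [exact: mx_regular_on_vel_star|exact: vel_star_normal].
Qed.

Let hJ6 k : has_vol_int (J6 k) 0.
Proof.
by apply: has_vol_int_ibp => //;
  [exact: regular_on_pres|exact: mx_regular_on_vel|exact: vel_normal].
Qed.

Let hJV : has_vol_int JV 0.
Proof.
apply: has_vol_int_viscous => //; first exact: mx_regular_on_ut_half.
have [n0|n_gt0] := posnP n; last by right; exact: hibp.
by left => x bx; rewrite n0 ut_half0_boundary.
Qed.

Let density k (x : vec) : R := 2^-1 * dot (vel s k x) (vel s k x) + K / 2 * psi s k x ^+ 2
  + K / (4 * eps c ^+ 2) * auxU s k x ^+ 2
  + tau ^+ 2 / 8 * dot (grad (pres s k) x) (grad (pres s k) x).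

Let hE k : has_vol_int (density k) (energy c s Omega k).
Proof.
rewrite /density /energy.
have h1 := has_vol_int_L2norm_mx hOmega (mx_regular_on_vel 0 k).
have h2 := has_vol_int_L2norm hOmega (regular_on_psi 0 k).
have h3 := has_vol_int_L2norm hOmega (regular_on_U 0 k).
have h4 := has_vol_int_L2norm_mx hOmega (mx_regular_on_grad (regular_on_pres 1 k)).
have := has_vol_intD hOmega (has_vol_intD hOmega (has_vol_intD hOmega (has_vol_intZ
  hOmega 2^-1 h1)
  (has_vol_intZ hOmega (K / 2) h2)) (has_vol_intZ hOmega (K / (4 * eps c ^+ 2)) h3))
  (has_vol_intZ hOmega (tau ^+ 2 / 8) h4).
rewrite (_ : (fun x => _) = density k)//.
by apply/funext => x; rewrite !sum_sqr_row.
Qed.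

Let gDg (x : vec) := dot (grad phs x) (mxapp (symgrad uh x) (grad phs x)).
Let Dg (x : vec) := mxapp (symgrad uh x) (grad phs x).

Let dissipation (x : vec) : R := tau / M * phd x ^+ 2 + tau * contract (S x) (gradv uh x).

Let hD : has_vol_int dissipation (tau / M * L2norm Omega phd ^+ 2 + tau *
  (mu1 c * L2norm Omega gDg ^+ 2 + mu4 c * L2norm_mx Omega (symgrad uh) ^+ 2
   + 2 * mu5 c * L2norm_mx Omega Dg ^+ 2)).
Proof.
have sg : mx_regular_on 0 (grad phs) by apply: mx_regular_on_grad;
  exact: regular_on_phi_star.
have sD : mx_regular_on 0 (symgrad uh) by apply: mx_regular_on_symgrad;
  exact: mx_regular_on_ut_half.
have sDg : mx_regular_on 0 Dg by exact: mx_regular_on_mxapp.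
have h1 := has_vol_int_L2norm hOmega (regular_on_phi_dot 0 n).
have h2 := has_vol_int_L2norm hOmega (regular_on_dot sg sDg).
have h3 := has_vol_int_L2norm_mx hOmega sD.
have h4 := has_vol_int_L2norm_mx hOmega sDg.
have := has_vol_intD hOmega (has_vol_intZ hOmega (tau / M) h1) (has_vol_intZ hOmega tau
  (has_vol_intD hOmega (has_vol_intD hOmega (has_vol_intZ hOmega (mu1 c) h2)
  (has_vol_intZ hOmega (mu4 c) h3)) (has_vol_intZ hOmega (2 * mu5 c) h4))).
rewrite (_ : (fun x => _) = dissipation)//.
by apply/funext => x; rewrite sum_sqr_row sum_sqr_contract /dissipation sigma_contract.
Qed.

(** In the momentum equation the capillary force is [phi-star grad W]; it cancels
    the transport part of [W phi-dot] up to the divergence [J4]. *)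
Let balance x : Omega x ->
  density n.+1 x + (-1) * density n x + dissipation x =
  K * J1 x + (- K) * J2 x + K / eps c ^+ 2 * J3 x + tau * J4 x + (- (tau / 2)) * J5 x
  + tau * JV x + (- (tau / 2)) * J6 n.+1 x + (- (tau / 2)) * J6 n x.
Proof.
move=> Ox; have cx := subset_closure Ox.
have [[hK hM he] [_ _ _ ht]] := hc.
have M0 : M != 0 by rewrite gt_eqF.
have t0 : tau != 0 by rewrite gt_eqF.
have e0 : eps c != 0 by rewrite gt_eqF.
have [_ _ /(_ n x Ox)[[q1 _ q3 q4] [q5 q6]] _] := hs.
have p1 := psi_laplacian n.+1 Ox; have p0 := psi_laplacian n Ox.
have hdg : divergence (grad dphi) x = psi s n x - psi s n.+1 x.
  by rewrite p1 p0 opprK addrC; exact: laplacianB (regular_on_phi 1 n.+1)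
    (regular_on_phi 1 n) Ox.
have B := dot_advection (vel_star s n) (mx_regular_on_ut_half 1 n) cx.
have gW : grad W x = M^-1 *: grad phd x.
  by rewrite -gradZ//; exact: regular_on_diff (regular_on_phi_dot 0 n) cx.
have gp : grad (fun y => pres s n.+1 y - pres s n y) x =
    grad (pres s n.+1) x - grad (pres s n) x.
  by apply: gradB; exact: regular_on_diff (regular_on_pres 0 _) cx.
rewrite gp in q5.
set gp1 := grad (pres s n.+1) x in q5 gp *.
set gp0 := grad (pres s n) x in q4 q5 gp *.
have ut_eq : ut s n.+1 x = vel s n.+1 x + (tau / 2) *: (gp1 - gp0).
  exact: projection_update q5.
have uh_eq : uh x = 2^-1 *: (vel s n.+1 x + vel s n x) + (tau / 4) *: (gp1 - gp0).
  exact: midpoint_velocity.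
have V := velocity_balance t0 q4 ut_eq uh_eq.
have D4 : tau * divergence (fun y => phs y *: uh y) x = tau * phd x - dphi x.
  by rewrite /phi_dot -/(dphi x) mulrDr mulrCA mulfV// mulr1 addrAC subrr add0r.
have q3' : auxU s n.+1 x - auxU s n x = 2 * dot (grad dphi x) (grad phs x).
  by rewrite dotC grad_dphi.
have ie : K / (4 * eps c ^+ 2) = K / eps c ^+ 2 / 4 by field.
rewrite /density ie /dissipation /J1 /J2 /J3 /J4 /J5 /JV /J6 hdg q6.
rewrite (divergence_vel n Ox) !mulr0 !add0r gW -/gp1 -/gp0.
rewrite [dot (grad psh x) (grad dphi x)]dotC [dot _ (Uh x *: _)]dotZr.
rewrite [dot _ (phs x *: _)]dotZr [dot (M^-1 *: _) _]dotZl.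
exact: scalar_balance V B D4 q1 q3'.
Qed.

Theorem energy_step : energy c s Omega n.+1 =
    energy c s Omega n
    - tau / M * L2norm Omega phd ^+ 2
    - tau *
      (mu1 c * L2norm Omega gDg ^+ 2 + mu4 c * L2norm_mx Omega (symgrad uh) ^+ 2
       + 2 * mu5 c * L2norm_mx Omega Dg ^+ 2).
Proof.
have L := has_vol_intD hOmega (has_vol_intD hOmega (hE n.+1) (has_vol_intZ hOmega (-1)
  (hE n))) hD.
have Rr := has_vol_intD hOmega (has_vol_intD hOmega (has_vol_intD hOmega (has_vol_intD
  hOmega
  (has_vol_intD hOmega (has_vol_intD hOmega (has_vol_intD hOmega (has_vol_intZ hOmega K
    hJ1)
  (has_vol_intZ hOmega (- K) hJ2)) (has_vol_intZ hOmega (K / eps c ^+ 2) hJ3))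
  (has_vol_intZ hOmega tau hJ4)) (has_vol_intZ hOmega (- (tau / 2)) hJ5))
  (has_vol_intZ hOmega tau hJV)) (has_vol_intZ hOmega (- (tau / 2)) (hJ6 n.+1)))
  (has_vol_intZ hOmega (- (tau / 2)) (hJ6 n)).
have := has_vol_int_eq L Rr balance; rewrite !mulr0 !addr0.
exact: solve_balance.
Qed.

End Step.
End EnergyLaw.

Theorem theorem3p2 (R : realType) (d : nat) (hd : d = 2%N \/ d = 3%N)
    (Omega : set 'rV[R]_d) (m : 'rV[R]_d -> 'rV[R]_d)
    (hOmega : bounded_smooth_domain Omega)
    (hm : outward_unit_normal Omega m)
    (c : cn_params R) (hc : cn_params_ok c)
    (s : cn_iterates R d) (hs : cn_scheme c s Omega m)
    (n : nat) (hibp : (0 < n)%N -> viscous_ibp_justified c s Omega n) :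
  energy c s Omega n.+1 =
    energy c s Omega n
    - dt c / mobM c * L2norm Omega (phi_dot c s n) ^+ 2
    - dt c *
      (mu1 c * L2norm Omega (fun x =>
         dot (grad (phi_star s n) x)
           (mxapp (symgrad (ut_half s n) x) (grad (phi_star s n) x))) ^+ 2
       + mu4 c * L2norm_mx Omega (symgrad (ut_half s n)) ^+ 2
       + 2 * mu5 c * L2norm_mx Omega (fun x =>
           mxapp (symgrad (ut_half s n) x) (grad (phi_star s n) x)) ^+ 2).
Proof.
exact: (energy_step hOmega hm hc hs hibp).
Qed.
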